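(* Let $n\ge1$ be an integer and let $X=\mathbf{P}^1\times\mathbf{P}^1\times\mathbf{P}^n\times\mathbf{P}^n$. Then: (i) $X$ has a defective $(2n+1)$-secant variety. (ii) The codimension of $\sigma_{2n+1}(X)$ in the ambient space $\mathbf{P}^{4(n+1)^2-1}$ is $2$. (iii) $T(1,1,n,n;2n;0^4)$ and $T(1,1,n,n;2n+2;0^4)$ are true.
   Context: Work over a field of characteristic zero (not necessarily algebraically closed). For non-negative integers $n_1,\dots,n_k$, $\mathbf{P}^{n_1}\times\cdots\times\mathbf{P}^{n_k}=\mathbf{P}(V_1)\times\cdots\times\mathbf{P}(V_k)$ denotes the Segre variety embedded in $\mathbf{P}(V_1\otimes\cdots\otimes V_k)$, where $\dim V_i=n_i+1$. The $s$-secant variety $\sigma_s(X)$ of $X\subseteq\mathbf{P}^m$ is the Zariski closure of the union of the linear spans of $s$-tuples of points of $X$. A Segre variety $X$ has a defective $s$-secant variety if $\dim\sigma_s(X)<\min\{\prod(n_i+1)-1,\ s\sum n_i+s-1\}$. For $p=v_1\otimes\cdots\otimes v_k\in X$ let $T_pX=\sum_{i=1}^k v_1\otimes\cdots\otimes v_{i-1}\otimes V_i\otimes v_{i+1}\otimes\cdots\otimes v_k$ (affine tangent space). The statement $T(n_1,\dots,n_k;s;0^k)$ is said to be true if, for $s$ generic points $p_1,\dots,p_s\in X$, the subspace $T_{p_1}X+\cdots+T_{p_s}X\subseteq V_1\otimes\cdots\otimes V_k$ has dimension $\min\{s(1+\sum n_i),\prod(n_i+1)\}$ (equivalently, $\sigma_s(X)$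 has the expected dimension). *)

(* Defs.v *)
From HB Require Import structures.
From mathcomp Require Import all_boot all_order all_algebra.
From mathcomp Require Import mpoly.

Set Implicit Arguments.
Unset Strict Implicit.
Unset Printing Implicit Defensive.

Import GRing.Theory.
Local Open Scope ring_scope.

(** * Projective varieties in P(K^I)

    [I] is a finite type of coordinates.  A subset of P(K^I) is given by the
    predicate on vectors satisfied by the nonzero representatives of its points;
    the zero vector represents no point.  The homogeneous coordinate ring of
    P(K^I) is [{mpoly K[#|I|]}], the variable ['X_(enum_rank a)] being the
    coordinate [a : I]. *)

Section Projective.

Variables (K : fieldType) (I : finType).

Local Notation vec := {ffun I -> K^o}.
Local Notation coord_ring := {mpoly K[#|I|]}.

Definition eval_at (F : coord_ring) (w : I -> K) : K :=
  F.@[fun r => w (enum_val r)].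

Definition vanishes_on (F : coord_ring) (Z : vec -> Prop) : Prop :=
  forall w, Z w -> eval_at F w = 0.

(** Only forms (homogeneous polynomials) define closed subsets of P(K^I). *)
Definition zariski_closure (Z : vec -> Prop) (w : vec) : Prop :=
  w != 0 /\
  forall (e : nat) (F : coord_ring),
    F \is e.-homog -> vanishes_on F Z -> eval_at F w = 0.

(** Homogeneous prime ideals not containing the irrelevant ideal, that is, the
    points of the scheme Proj of the coordinate ring, or equivalently the
    irreducible closed subsets of that scheme. *)
Record relevant_homog_prime (P : coord_ring -> Prop) : Prop := {
  ideal0 : P 0;
  idealD : forall F G, P F -> P G -> P (F + G);
  idealM : forall F G, P G -> P (F * G);
  ideal_homog : forall (e : nat) F, P F -> P (pihomog mdeg e F);
  ideal_prime : forall F G, P (F * G) -> P F \/ P G;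
  ideal_relevant : exists r : 'I_#|I|, ~ P 'X_r
}.

(** A chain of length [e] of relevant homogeneous primes containing the
    homogeneous ideal of [Z].  This is the dimension theory of the scheme Proj
    of the homogeneous coordinate ring of [Z]; over a field which is not
    algebraically closed the Zariski topology on the rational points would not
    do, since a closed irreducible subset may contain too few of them. *)
Definition has_prime_chain (Z : vec -> Prop) (e : nat) : Prop :=
  exists P : 'I_e.+1 -> coord_ring -> Prop,
    [/\ forall i, relevant_homog_prime (P i),
        forall i c F, F \is c.-homog -> vanishes_on F Z -> P i F
      & forall i j : 'I_e.+1, (i < j)%N ->
          (forall F, P i F -> P j F) /\ (exists F, P j F /\ ~ P i F)].

(** The (Krull) dimension of the Zariski closure of [Z]; the empty set has no
    dimension in this sense. *)
Definition proj_dim (Z : vec -> Prop) (e : nat) : Prop :=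
  has_prime_chain Z e /\ forall e', has_prime_chain Z e' -> (e' <= e)%N.

Definition secant_variety (X : vec -> Prop) (s : nat) : vec -> Prop :=
  zariski_closure (fun w => w != 0 /\
    exists p : 'I_s -> vec,
      (forall j, X (p j)) /\ w \in (\sum_(j < s) <[p j]>)%VS).

End Projective.

(** * Segre varieties

    [d = (n_1, ..., n_k)] is the tuple of projective dimensions of the factors,
    V_i = K^(n_i + 1), and the tensor product of the V_i is the space of
    functions on the multi-indices (a_1, ..., a_k) with 0 <= a_i <= n_i. *)

Section Segre.

Variables (K : fieldType) (k : nat) (d : k.-tuple nat).

Definition multi_index : finType := {dffun forall i : 'I_k, 'I_(tnth d i).+1}.

Definition tensor_space : vectType K := {ffun multi_index -> K^o}.

Definition factors : Type := forall i : 'I_k, 'rV[K]_(tnth d i).+1.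

Definition tens (v : factors) : tensor_space :=
  [ffun a : multi_index => \prod_(i < k) v i 0 (a i)].

Definition nonzero_factors (v : factors) : Prop := forall i, v i != 0.

Definition segre (p : tensor_space) : Prop :=
  exists2 v : factors, nonzero_factors v & p = tens v.

(** v_1 (x) ... (x) v_(i-1) (x) x (x) v_(i+1) (x) ... (x) v_k *)
Definition tens_subst (v : factors) (i : 'I_k) (x : 'rV[K]_(tnth d i).+1) :
  tensor_space := tens (dfwith v x).

Fact tens_subst_is_linear v i : linear (@tens_subst v i).
Proof.
move=> c x y; apply/ffunP => a; rewrite !ffunE.
rewrite !(bigD1 (P := predT) i) //= !dfwith_in !mxE mulrDl -mulrA.
by congr (_ * (_ * _) + _ * _); apply: eq_bigr => j ji;
  rewrite !dfwith_out 1?eq_sym.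
Qed.

HB.instance Definition _ v i :=
  GRing.isLinear.Build K _ _ _ (@tens_subst v i) (@tens_subst_is_linear v i).

(** The affine tangent space to the Segre variety at [tens v]. *)
Definition tangent_space (v : factors) : {vspace tensor_space} :=
  (\sum_(i < k) limg (linfun (@tens_subst v i)))%VS.

Lemma tangent_spaceP v (w : tensor_space) :
  reflect (exists x : factors, w = \sum_(i < k) tens_subst v (x i))
          (w \in tangent_space v).
Proof.
apply: (iffP memv_sumP) => [[u ux ->]|[x ->]].
  have h i : exists x, u i == tens_subst v (i := i) x.
    by have /memv_imgP[x _ ->] := ux i isT; exists x; rewrite lfunE.
  exists (fun i => xchoose (h i)); apply: eq_bigr => i _.
  exact/eqP/(xchooseP (h i)).
exists (fun i => tens_subst v (x i)) => // i _.
by apply/memv_imgP; exists (x i); rewrite ?memvf // lfunE.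
Qed.

(** Forms on P(V_1 (x) ... (x) V_k)^s: polynomials in the coordinates of
    [s] tensors, homogeneous of degree [e j] in those of the [j]-th one. *)
Definition multihomog (s : nat) (F : {mpoly K[#|{: 'I_s * multi_index}|]}) :
    Prop :=
  exists e : 'I_s -> nat, forall m, m \in msupp F ->
    forall j, (\sum_(a : multi_index) m (enum_rank (j, a)) = e j)%N.

Definition eval_points (s : nat) (F : {mpoly K[#|{: 'I_s * multi_index}|]})
    (v : 'I_s -> factors) : K :=
  eval_at F (fun ja => tens (v ja.1) ja.2).

(** [Q] holds for [s] generic points of the Segre variety X: it holds on a
    nonempty basic Zariski open subset of X^s, hence on a dense one since X^s is
    irreducible.  Points are presented by their factors. *)
Definition for_generic_points (s : nat) (Q : ('I_s -> factors) -> Prop) : Prop :=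
  exists F : {mpoly K[#|{: 'I_s * multi_index}|]},
    [/\ multihomog F,
        exists v, (forall j, nonzero_factors (v j)) /\ eval_points F v != 0
      & forall v, (forall j, nonzero_factors (v j)) -> eval_points F v != 0 ->
          Q v].

(** The statement T(n_1, ..., n_k; s; 0^k). *)
Definition T_true (s : nat) : Prop :=
  for_generic_points (fun v : 'I_s -> factors =>
    \dim (\sum_(j < s) tangent_space (v j))%VS =
    minn (s * (1 + \sum_(i < k) tnth d i))%N (\prod_(i < k) (tnth d i).+1)%N).

Definition segre_secant (s : nat) : tensor_space -> Prop :=
  secant_variety segre s.

Definition defective (s : nat) : Prop :=
  exists2 e, proj_dim (segre_secant s) e &
    (e < minn (\prod_(i < k) (tnth d i).+1 - 1)
              (s * (\sum_(i < k) tnth d i) + s - 1))%N.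

End Segre.

Arguments segre_secant K {k} d s _.
Arguments defective K {k} d s.
Arguments T_true K {k} d s.

(* Main.v *)
Require Import Defs.
From HB Require Import structures.
From mathcomp Require Import all_boot all_order all_algebra.
From mathcomp Require Import fingroup perm mpoly.
From mathcomp Require Import zify ring.

(** Write [m = n + 1], so that a tensor is a 2 x 2 array of m x m matrices
    [M_ij] and the ambient affine space has dimension [N = 4 m ^ 2].

    Upper bound of the dimension.  The 2m x 2m matrices with blocks
    [M_00, M_01; M_10, M_11] and [M_00, M_10; M_01, M_11] are flattenings of the
    tensor, so they have rank at most [2n + 1 = 2m - 1] on the secant variety,
    and both determinants vanish there.  Two well chosen entries of [M_11] lie on
    one row of both matrices, hence enter both determinants affinely: by Cramer's
    rule ([flattening_cramer]), the secant variety is contained in the closure of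
    the image of a polynomial map in [N - 2] variables, provided that the 2 x 2
    determinant [Delta] of the system does not vanish identically, which is
    checked at one point ([Delta_witness]).  By counting, [N - 1] polynomials in
    [N - 2] variables are algebraically dependent, and an algebraic dependence
    bounds the length of chains of primes ([prime_chain_relation]); this gives
    dimension at most [N - 3] ([secant_chain_bound]).

    Lower bound.  If the tangent spaces at the [2n + 1] points [p_j] span a space
    of dimension [r + 1], then the parametrization of the secant cone, restricted
    to an (r + 1)-dimensional family of parameters on which its differential is
    injective, stays of maximal rank when the parameters are fixed one after the
    other at the base point.  The kernels of these restrictions are a chain of
    [r] steps: they are separated by algebraic relations, which exist for one
    parameter less by counting, and not before since polynomials with independent
    linear parts are algebraically independent
    ([prime_chain_of_tangent_spaces]).

    The tangent spaces.  All the points are taken over the curve of points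
    [((1, x), (1, x ^ 2))] of P^1 x P^1, so that a linear form on the tensors
    restricts, for each pair [(k, l)] of indices of the last two factors, to an
    arbitrary polynomial of degree at most 3 in [x].  Being orthogonal to the tangent
    spaces means that these polynomials have prescribed zeros.  With three points
    carried by the first two coordinates of P^n x P^n, and two points for each
    further coordinate, the conditions can be solved pair by pair, and leave a
    space of dimension 2 ([kills_eq0]): the tangent spaces at these [2n + 1]
    points span a space of dimension [N - 2].  One more point kills the two
    remaining dimensions, and as the only linear relation between the tangent
    spaces involves the third point, the [2n] other ones have independent tangent
    spaces; this proves (iii) by semicontinuity ([T_true_of_dim]). *)

Set Implicit Arguments.
Unset Strict Implicit.
Unset Printing Implicit Defensive.

Import GRing.Theory.
Local Open Scope ring_scope.

(** * Values of polynomials in commutative algebras *)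

Lemma rmorph_mmap n (K : nzRingType) (A B : comNzRingType) (f : {rmorphism K -> A})
    (g : {rmorphism A -> B}) (h : {rmorphism K -> B}) (W : 'I_n -> A) F :
  (forall c, g (f c) = h c) -> g (mmap f W F) = mmap h (fun i => g (W i)) F.
Proof.
move=> gf; rewrite /mmap rmorph_sum; apply: eq_bigr => m _.
rewrite rmorphM gf /mmap1 rmorph_prod; congr (_ * _).
by apply: eq_bigr => i _; rewrite rmorphXn.
Qed.

Lemma eq_mmap n (K : nzRingType) (A : nzRingType) (f : K -> A) (W W' : 'I_n -> A) F :
  W =1 W' -> mmap f W F = mmap f W' F.
Proof.
move=> eW; rewrite /mmap; apply: eq_bigr => m _; congr (_ * _).
by rewrite /mmap1; apply: eq_bigr => i _; rewrite eW.
Qed.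

Section Evaluation.

Variables (K : fieldType) (I : finType).

(** The coordinates are indexed by [I], and the values may be taken at points, at
    generic points or along families of points, according to the algebra [A]. *)
Definition ev (A : comNzRingType) (f : {rmorphism K -> A}) (W : I -> A)
    (F : {mpoly K[#|I|]}) : A :=
  mmap f (fun r => W (enum_val r)) F.

HB.instance Definition _ A f W :=
  GRing.RMorphism.copy (@ev A f W) (mmap f (fun r => W (enum_val r))).

Variables (A : comNzRingType) (f : {rmorphism K -> A}).
Implicit Types (W : I -> A) (F : {mpoly K[#|I|]}).

Lemma evX W a : ev f W 'X_(enum_rank a) = W a.
Proof. by rewrite /ev mmapX mmap1U enum_rankK. Qed.

Lemma evC W c : ev f W c%:MP = f c.
Proof. exact: mmapC. Qed.

Lemma evZ W c F : ev f W (c *: F) = f c * ev f W F.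
Proof. exact: mmapZ. Qed.

Lemma eq_ev W W' F : W =1 W' -> ev f W F = ev f W' F.
Proof. by move=> eW; apply: eq_mmap => i; apply: eW. Qed.

Lemma ev_comp (B : comNzRingType) (g : {rmorphism A -> B})
    (h : {rmorphism K -> B}) W F :
  (forall c, g (f c) = h c) -> g (ev f W F) = ev h (fun a => g (W a)) F.
Proof. exact: rmorph_mmap. Qed.

Lemma ev_homog W (c : A) e F : F \is e.-homog ->
  ev f (fun a => c * W a) F = c ^+ e * ev f W F.
Proof.
move=> /dhomogP hF; rewrite /ev /mmap mulr_sumr.
rewrite big_seq [RHS]big_seq; apply: eq_bigr => m /hF me.
rewrite mulrCA; congr (_ * _); rewrite /mmap1.
under eq_bigr do rewrite exprMn.
by rewrite big_split /= prodrXr -[X in c ^+ X]mdegE; congr (c ^+ _ * _).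
Qed.

Lemma ev_scale W (c : A) F :
  ev f (fun a => c * W a) F =
  \sum_(e < msize F) c ^+ e * ev f W (pihomog mdeg e F).
Proof.
rewrite {1}(pihomog_partitionE (leqnn (msize F))) raddf_sum /=.
by apply: eq_bigr => e _; apply: ev_homog; apply: pihomogP.
Qed.

End Evaluation.

(** A grading can be read off from the action of scalars by giving the scalar
    the generic value ['X ^+ k]: no cancellation can then occur between the
    homogeneous components. *)
Lemma ev_scale_eq0 (K : fieldType) (I : finType) (A : comNzRingType)
    (f : {rmorphism K -> A}) k (h : {rmorphism K -> {poly A}})
    (W : I -> A) (F : {mpoly K[#|I|]}) e :
  (0 < k)%N -> (forall c, h c = (f c)%:P) ->
  ev h (fun a => 'X^k * (W a)%:P) F = 0 -> ev f W (pihomog mdeg e F) = 0.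
Proof.
move=> k_gt0 hf; have [e_lt|e_ge] := ltnP e (msize F); last first.
  move=> _; suff -> : pihomog mdeg e F = 0 by rewrite raddf0.
  rewrite pihomogE big_seq_cond big_pred0 // => m.
  apply/andP => -[/msize_mdeg_lt m_lt /eqP me].
  by have := leq_trans m_lt e_ge; rewrite [X in (X < _)%N -> _]me ltnn.
rewrite ev_scale.
have -> : \sum_(i < msize F) ('X^k) ^+ i *
      ev h (fun a => (W a)%:P) (pihomog mdeg i F) =
    \sum_(i < msize F) (ev f W (pihomog mdeg i F))%:P * 'X^(k * i).
  apply: eq_bigr => i _; rewrite mulrC exprM; congr (_ * _).
  exact/esym/(ev_comp (g := polyC)).
move/(congr1 (fun p : {poly A} => p`_(k * e))).
rewrite coef0 coef_sum (bigD1 (Ordinal e_lt)) //= coefMXn ltnn subnn coefC eqxx.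
rewrite big1 ?addr0 // => i ie; rewrite coefMXn coefC.
have {}ie : i != e :> nat by [].
case: ltnP => // le_ie; rewrite subn_eq0 leq_pmul2l // leqNgt.
by rewrite ltn_neqAle ie -(leq_pmul2l k_gt0) le_ie.
Qed.

(** * Algebraic dependence and chains of primes *)

Lemma msizeX_le (K : fieldType) n (g : {mpoly K[n]}) D k :
  (msize g <= D.+1)%N -> (msize (g ^+ k) <= (D * k).+1)%N.
Proof.
move=> gD; elim: k => [|k IHk]; first by rewrite expr0 msize1.
have [->|g0] := eqVneq g 0; first by rewrite expr0n msize0.
rewrite exprSr; have [->|gk0] := eqVneq (g ^+ k) 0.
  by rewrite mul0r msize0.
rewrite msizeM // mulnS; move: gD IHk.
by move: (msize g) (msize (g ^+ k)) (D * k)%N => a b e; lia.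
Qed.

Lemma msize_prod_le (K : fieldType) n N (g : 'I_N -> {mpoly K[n]}) d :
  (forall i, msize (g i) <= d.+1)%N -> (msize (\prod_i g i) <= (d * N).+1)%N.
Proof.
elim: N g => [|N IHN] g gd; first by rewrite big_ord0 msize1.
rewrite big_ord_recr /=.
have {IHN} := IHN (fun i => g (widen_ord (leqnSn N) i)) (fun i => gd _).
have := gd ord_max; move: (g ord_max) => h; move: (\prod_(_ < _) _) => p hd pd.
have [->|h0] := eqVneq h 0; first by rewrite mulr0 msize0.
have [->|p0] := eqVneq p 0; first by rewrite mul0r msize0.
rewrite msizeM // mulnS; move: hd pd.
by move: (msize h) (msize p) (d * N)%N => a b e; lia.
Qed.

(** Counting: the [k ^ n.+1] products of powers of exponents less than [k] lie
    in a space of polynomials whose dimension only grows like [k ^ n]. *)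
Lemma alg_dependent (K : fieldType) n (g : 'I_n.+1 -> {mpoly K[n]}) :
  exists k, exists c : {ffun 'I_n.+1 -> 'I_k} -> K,
    (exists q, c q != 0) /\ \sum_q c q *: \prod_i g i ^+ q i = 0.
Proof.
pose D := \max_i msize (g i).
have gD i : (msize (g i) <= D.+1)%N by rewrite ltnW // ltnS leq_bigmax.
(* [B ^ n < k ^ n.+1] as soon as [C ^ n < k]. *)
pose C := (D * n.+1).+1; pose k := (C ^ n).+1; pose B := (C * k)%N.
have szP (q : {ffun 'I_n.+1 -> 'I_k}) :
    (msize (\prod_i g i ^+ q i) <= B)%N.
  apply: leq_trans (msize_prod_le (d := D * (C ^ n)) _) _ => [i|].
    apply: leq_trans (msizeX_le _ (gD i)) _.
    by rewrite ltnS leq_mul2l -ltnS ltn_ord orbT.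
  by rewrite /B /k /C; nia.
pose rows := {ffun 'I_n.+1 -> 'I_k}; pose cols := {ffun 'I_n -> 'I_B}.
pose mon (b : cols) : 'X_{1..n} := [multinom (b i : nat) | i < n].
pose M : 'M[K]_(#|{: rows}|, #|{: cols}|) :=
  \matrix_(q, b) (\prod_i g i ^+ (enum_val q : rows) i)@_(mon (enum_val b)).
have lt_dim : (#|{: cols}| < #|{: rows}|)%N.
  rewrite !card_ffun !card_ord /B expnMn expnSr /k.
  by rewrite mulnC ltn_pmul2l ?expn_gt0.
have /rowV0Pn[v /sub_kermxP vM v0] : kermx M != 0.
  rewrite -mxrank_eq0 mxrank_ker subn_eq0 -ltnNge.
  exact: leq_ltn_trans (rank_leq_col _) lt_dim.
exists k, (fun q => v 0 (enum_rank q)); split.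
  move/rV0Pn: v0 => [j vj]; exists (enum_val j); by rewrite enum_valK.
apply/mpolyP => m; rewrite mcoeff0 raddf_sum /=.
have [m_lt|m_ge] := boolP [forall i, (m i < B)%N].
  have ltm i : (m i < B)%N by move/forallP: m_lt.
  pose b : cols := [ffun i => Ordinal (ltm i)].
  have em : mon b = m by apply/mnmP => i; rewrite mnmE ffunE.
  move/matrixP/(_ 0 (enum_rank b)): vM; rewrite !mxE => vM.
  rewrite -[RHS]vM (reindex (@enum_rank rows)) /=; last first.
    exact/onW_bij/enum_rank_bij.
  by apply: eq_bigr => q _; rewrite mcoeffZ mxE !enum_rankK em.
rewrite big1 // => q _; rewrite mcoeffZ; apply/eqP; rewrite mulf_eq0.
apply/orP; right; rewrite mcoeff_eq0; apply: msize_mdeg_ge.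
apply: leq_trans (szP q) _.
move: m_ge; rewrite negb_forall => /existsP[i]; rewrite -leqNgt => /leq_trans.
by apply; rewrite mdegE (bigD1 i) //= leq_addr.
Qed.

Section PrimeChain.

Variables (K : fieldType) (A : comNzRingType) (f : {rmorphism K -> A}).
Variables (n : nat) (P : nat -> A -> Prop) (x : nat -> A).
Hypothesis P_add : forall i a b, (i <= n)%N -> P i a -> P i b -> P i (a + b).
Hypothesis P_mul : forall i a b, (i <= n)%N -> P i b -> P i (a * b).
Hypothesis P_zero : forall i, (i <= n)%N -> P i 0.
Hypothesis P_prime : forall i a b, (i < n)%N -> P i (a * b) -> P i a \/ P i b.
Hypothesis P_sub : forall i a, (i < n)%N -> P i a -> P i.+1 a.
Hypothesis Px : forall i, (i < n)%N -> P i.+1 (x i).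
Hypothesis NPx : forall i, (i < n)%N -> ~ P i (x i).

(** This is the constructive form of the bound of Krull dimension by
    transcendence degree.  In a relation whose value lies in the [i]-th prime,
    factor out the lowest power of [x i] that occurs: the quotient is in that
    prime, hence in the next one, which contains [x i]; so only the terms of
    lowest degree in [x i] matter there.  Once all the elements are used up, a
    single nonzero coefficient is left. *)
Lemma prime_chain_relation k (c : {ffun 'I_n -> 'I_k} -> K) q0 :
  c q0 != 0 -> P 0 (\sum_q f (c q) * \prod_(i < n) x i ^+ q i) -> P n 1.
Proof.
move=> cq0 Pc0.
have P_sum i (T : finType) (Q : pred T) (F : T -> A) : (i <= n)%N ->
    (forall t, Q t -> P i (F t)) -> P i (\sum_(t | Q t) F t).
  by move=> i_le PF; apply: big_ind; [exact: P_zero | move=> ? ?; exact: P_add | by []].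
have P_exp i a e : (i < n)%N -> ~ P i a -> forall b, P i (a ^+ e * b) -> P i b.
  move=> i_lt NPa; elim: e => [|e IHe] b; first by rewrite mul1r.
  by rewrite exprS -mulrA => /(P_prime i_lt)[/NPa|/IHe].
have key j : (j <= n)%N -> exists S : {set {ffun 'I_n -> 'I_k}},
    [/\ S != set0, {in S, forall q, c q != 0},
        {in S &, forall (q q' : {ffun 'I_n -> 'I_k}) (i : 'I_n),
          (i < j)%N -> q i = q' i} &
        P j (\sum_(q in S) f (c q) * \prod_(i < n | (j <= i)%N) x i ^+ q i)].
  elim: j => [_|j IHj j_lt].
    exists [set q | c q != 0]; split => //.
    - by apply/set0Pn; exists q0; rewrite inE.
    - by move=> q; rewrite inE.
    - rewrite (_ : \sum_(q in _) _ = \sum_q f (c q) * \prod_(i < n) x i ^+ q i) //.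
      rewrite [RHS](bigID (fun q => c q != 0)) /= [X in _ + X]big1 ?addr0.
        by apply: eq_big => q; rewrite ?inE.
      by move=> q; rewrite negbK => /eqP->; rewrite rmorph0 mul0r.
  have [S [S0 cS eqS PS]] := IHj (ltnW j_lt).
  pose o := Ordinal j_lt; have /set0Pn[q1 q1S] := S0.
  pose qm := [arg min_(q < q1 in S) (q o : nat)].
  have [qmS qm_min] : qm \in S /\ forall q, q \in S -> (qm o <= q o)%N.
    by rewrite /qm; case: arg_minnP => // q qS qmin; split.
  exists [set q in S | q o == qm o]; split.
  - by apply/set0Pn; exists qm; rewrite inE qmS eqxx.
  - by move=> q; rewrite inE => /andP[/cS].
  - move=> q q'; rewrite !inE => /andP[qS /eqP qo] /andP[q'S /eqP q'o] i.
    rewrite ltnS leq_eqVlt => /predU1P[ij|]; last exact: eqS.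
    by have -> : i = o by [exact: val_inj]; rewrite qo q'o.
  have {PS} : P j (x j ^+ qm o * \sum_(q in S) x j ^+ (q o - qm o) *
      (f (c q) * \prod_(i < n | (j < i)%N) x i ^+ q i)).
    rewrite (_ : _ * _ = \sum_(q in S)
      f (c q) * \prod_(i < n | (j <= i)%N) x i ^+ q i) //.
    rewrite mulr_sumr; apply: eq_bigr => q qS.
    rewrite mulrA -exprD subnKC ?qm_min // mulrCA; congr (_ * _).
    rewrite [RHS](bigD1 o) //=; congr (_ * _); apply: eq_bigl => i.
    by rewrite ltn_neqAle andbC -val_eqE eq_sym.
  move/(P_exp _ _ _ j_lt (NPx j_lt))/(P_sub j_lt).
  set G := (X in P _ X -> _) => PG.
  have -> : \sum_(q in [set q in S | q o == qm o])
      f (c q) * \prod_(i < n | (j < i)%N) x i ^+ q i =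
      G + (-1) * \sum_(q in S | q o != qm o) x j ^+ (q o - qm o) *
      (f (c q) * \prod_(i < n | (j < i)%N) x i ^+ q i).
    rewrite mulN1r; apply/eqP; rewrite eq_sym subr_eq /G; apply/eqP.
    rewrite (bigID (fun q : {ffun 'I_n -> 'I_k} => q o == qm o)) /=.
    congr (_ + _); apply: eq_big => q; first by rewrite inE.
    by move=> /andP[_ /eqP ->]; rewrite subnn mul1r.
  apply: P_add => //; apply: P_mul => //; apply: P_sum => // q /andP[qS qo].
  have : (qm o < q o)%N by rewrite ltn_neqAle qm_min // andbT eq_sym.
  move=> /subnSK <-; rewrite exprSr -mulrA [x j * _]mulrC mulrA.
  by apply: P_mul => //; exact: Px.
have [S [/set0Pn[q qS] cS eqS]] := key n (leqnn n).
rewrite (big_pred1 q) => [|q']; last first.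
  apply/idP/eqP => [q'S|->//]; apply/ffunP => i; exact: eqS.
rewrite big_pred0 ?mulr1 => [Pc|i]; last by rewrite leqNgt ltn_ord.
have -> : (1 : A) = f (c q)^-1 * f (c q).
  by rewrite -rmorphM mulVf ?rmorph1 // cS.
exact: P_mul.
Qed.

End PrimeChain.

Lemma mcoeff_pihomog (K : fieldType) n (F : {mpoly K[n]}) d m :
  (pihomog mdeg d F)@_m = if mdeg m == d then F@_m else 0.
Proof.
elim/mpolyind: F => [|c m' F _ _ IHF]; first by rewrite pihomog0 mcoeff0 if_same.
rewrite pihomogD mcoeffD IHF linearZ /= mcoeffZ pihomogX mcoeffD mcoeffZ mcoeffX.
have [<-|m'm] := eqVneq m' m; first by case: eqP; rewrite ?mcoeffX ?eqxx ?mcoeff0 ?mulr0 ?addr0.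
rewrite mulr0 add0r (_ : mcoeff _ (if _ then _ else _) = 0) ?mulr0 ?add0r //.
by case: ifP; rewrite ?mcoeff0 // mcoeffX (negPf m'm).
Qed.

Section ChainBound.

Variables (K : fieldType) (I : finType) (Z : {ffun I -> K^o} -> Prop).
Local Notation R := {mpoly K[#|I|]}.

(** A chain of length [e] is prolonged by the irrelevant ideal, which provides
    [e.+1] elements separating consecutive primes; if [r <= e], then [r.+1] of
    them satisfy a relation after substitution of [eta], hence modulo the
    smallest prime. *)
Lemma prime_chain_lt r (eta : I -> {mpoly K[r]}) e :
  (forall (F : R) d, ev (@mpolyC r K) eta F = 0 ->
     vanishes_on (pihomog mdeg d F) Z) ->
  has_prime_chain Z e -> (e < r)%N.
Proof.
move=> etaZ [P [Pprime PZ Pchain]]; rewrite ltnNge; apply/negP => r_le_e.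
pose Q i (F : R) := if (i <= e)%N then P (inord i) F else F@_0%MM = 0.
have QP i : (i <= e)%N -> Q i = P (inord i) by rewrite /Q => ->.
have Psub i : (i < e)%N ->
    (forall F, P (inord i) F -> P (inord i.+1) F) /\
    exists F, P (inord i.+1) F /\ ~ P (inord i) F.
  by move=> i_lt; apply: Pchain; rewrite !inordK // ltnS ltnW.
have Pmul i (F G : R) : P i G -> P i (F * G) by apply: idealM; apply: Pprime.
have Pproper i : ~ P i 1.
  move=> P1; have [v] := ideal_relevant (Pprime i); apply.
  by rewrite -['X_v]mulr1; apply: Pmul.
have Plast F : P (inord e) F -> F@_0%MM = 0.
  move=> /(ideal_homog (Pprime _))-/(_ 0%N) PF0; apply/eqP/negPn/negP => F0.
  apply: (Pproper (inord e)); rewrite -(mpolyC1 _ K) -(mulVf F0) mpolyCM.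
  apply: Pmul; rewrite -[X in P _ X](_ : pihomog mdeg 0 F = _) //.
  apply/mpolyP => m; rewrite mcoeffC mcoeff_pihomog mdeg_eq0.
  by case: eqP => [->|_]; rewrite ?mulr1 ?mulr0.
have [x xP] : exists x : 'I_r.+1 -> R, forall i : 'I_r.+1,
    Q i.+1 (x i) /\ ~ Q i (x i).
  apply: (@fin_all_exists _ (fun=> R)
    (fun (i : 'I_r.+1) (F : R) => Q i.+1 F /\ ~ Q i F)) => i.
  have i_le : (i <= e)%N.
    by rewrite (leq_trans _ r_le_e) // -ltnS.
  have [i_lt|e_le] := ltnP i e.
    by rewrite (QP _ i_le) (QP _ i_lt); have [_] := Psub i i_lt.
  have ie : i = e :> nat by apply/eqP; rewrite eqn_leq i_le.
  have [v NPv] := ideal_relevant (Pprime (inord i)).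
  exists 'X_v; rewrite (QP _ i_le); split=> //; rewrite /Q ltnNge e_le /=.
  by rewrite mcoeffX mnm1_eq0.
have [k [c [[q0 cq0] cx]]] := alg_dependent (fun i => ev (@mpolyC r K) eta (x i)).
pose y i := x (inord i).
suff: Q r.+1 1.
  rewrite /Q; case: ifP => _; first exact: Pproper.
  by move/eqP; rewrite mcoeff1 eqxx oner_eq0.
apply: (@prime_chain_relation K R (@mpolyC _ K) r.+1 Q y _ _ _ _ _ _ _ k c q0 cq0).
- move=> i a b _; rewrite /Q; case: ifP => _; first exact: (idealD (Pprime _)).
  by rewrite mcoeffD => -> ->; rewrite addr0.
- move=> i a b _; rewrite /Q; case: ifP => _; first exact: Pmul.
  by rewrite rmorphM /= => ->; rewrite mulr0.
- move=> i _; rewrite /Q; case: ifP => _; first exact: (ideal0 (Pprime _)).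
  by rewrite mcoeff0.
- move=> i a b _; rewrite /Q; case: ifP => _; first exact: (ideal_prime (Pprime _)).
  by rewrite rmorphM /= => /eqP; rewrite mulf_eq0 => /orP[]/eqP; [left|right].
- move=> i a i_lt; have i_le : (i <= e)%N.
    by apply: leq_trans r_le_e.
  rewrite (QP _ i_le); have [i_lte|e_le] := ltnP i e.
    by rewrite (QP _ i_lte); have [Pi _] := Psub i i_lte; apply: Pi.
  have ie : i = e :> nat by apply/eqP; rewrite eqn_leq i_le.
  have -> : inord i = inord e :> 'I_e.+1 by congr inord.
  by rewrite /Q ltnNge e_le; exact: Plast.
- by move=> i i_lt; have [] := xP (inord i); rewrite inordK.
- by move=> i i_lt; have [_] := xP (inord i); rewrite inordK.
- set F := (X in Q 0 X).
  have etaF : ev (@mpolyC r K) eta F = 0.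
    rewrite raddf_sum -[RHS]cx /=; apply: eq_bigr => q _.
    rewrite rmorphM /= evC mul_mpolyC rmorph_prod; congr (_ *: _).
    by apply: eq_bigr => i _; rewrite rmorphXn /y inord_val.
  rewrite QP // [F](pihomog_partitionE (leqnn (msize F))).
  apply: big_ind; [exact: (ideal0 (Pprime _))| |].
    by move=> a b; exact: (idealD (Pprime _)).
  move=> d _; apply: PZ (pihomogP _ _ _) _; exact: etaZ.
Qed.

End ChainBound.

(** * Chains of primes from a parametrization *)

Section Order.

Variables (K : fieldType) (n : nat).
Implicit Types (F G : {mpoly K[n]}).

Definition ord_ge k F := forall m, (mdeg m < k)%N -> F@_m = 0.

Lemma ord_ge0 k : ord_ge k 0.
Proof. by move=> m _; rewrite mcoeff0. Qed.

Lemma ord_geD k F G : ord_ge k F -> ord_ge k G -> ord_ge k (F + G).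
Proof. by move=> hF hG m mk; rewrite mcoeffD hF ?hG ?addr0. Qed.

Lemma ord_geZ k c F : ord_ge k F -> ord_ge k (c *: F).
Proof. by move=> hF m mk; rewrite mcoeffZ hF ?mulr0. Qed.

Lemma ord_ge_sum k (T : Type) (s : seq T) (Q : pred T) (F : T -> {mpoly K[n]}) :
  (forall t, Q t -> ord_ge k (F t)) -> ord_ge k (\sum_(t <- s | Q t) F t).
Proof.
by move=> hF; apply: big_ind => //; [exact: ord_ge0 | move=> ? ?; exact: ord_geD].
Qed.

Lemma ord_geW k k' F : (k' <= k)%N -> ord_ge k F -> ord_ge k' F.
Proof. by move=> kk hF m mk; apply: hF; apply: leq_trans mk kk. Qed.

Lemma ord_geM k1 k2 F G :
  ord_ge k1 F -> ord_ge k2 G -> ord_ge (k1 + k2) (F * G).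
Proof.
move=> hF hG m mk; rewrite mcoeffM big1 // => -[a b] /= /eqP em.
have {mk em} : (mdeg a + mdeg b < k1 + k2)%N by rewrite -mdegD -em.
move=> mk.
have [a_lt|a_ge] := ltnP (mdeg a) k1; first by rewrite hF ?mul0r.
by rewrite [X in _ * X]hG ?mulr0 // -(ltn_add2l k1); apply: leq_ltn_trans mk; rewrite leq_add2r.
Qed.

Lemma ord_geX k e F : ord_ge k F -> ord_ge (k * e) (F ^+ e).
Proof.
move=> hF; elim: e => [|e IHe]; first by rewrite muln0.
by rewrite exprS mulnS; apply: ord_geM.
Qed.

Lemma ord_ge_var i : ord_ge 1 ('X_i : {mpoly K[n]}).
Proof.
by move=> m; rewrite ltnS leqn0 mdeg_eq0 => /eqP->; rewrite mcoeffX mnm1_eq0.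
Qed.

Definition same_lowest k F G := ord_ge k G /\ ord_ge k.+1 (F - G).

Lemma same_lowestM k1 k2 F1 G1 F2 G2 :
  same_lowest k1 F1 G1 -> same_lowest k2 F2 G2 ->
  same_lowest (k1 + k2) (F1 * F2) (G1 * G2).
Proof.
move=> [g1 d1] [g2 d2]; split; first exact: ord_geM.
have -> : F1 * F2 - G1 * G2 = (F1 - G1) * F2 + G1 * (F2 - G2) by ring.
apply: ord_geD; last by rewrite -addnS; apply: ord_geM.
rewrite -addSn; apply: ord_geM => //; rewrite -(subrK G2 F2).
by apply: ord_geD => //; apply: ord_geW d2.
Qed.

Lemma same_lowest1 : same_lowest 0 1 1.
Proof. by split=> [m //|]; rewrite subrr; apply: ord_ge0. Qed.

Lemma same_lowestX k e F G :
  same_lowest k F G -> same_lowest (k * e) (F ^+ e) (G ^+ e).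
Proof.
move=> hFG; elim: e => [|e IHe]; first by rewrite muln0; apply: same_lowest1.
by rewrite !exprS mulnS; apply: same_lowestM.
Qed.

Lemma same_lowest_prod (T : finType) (d : T -> nat) (F G : T -> {mpoly K[n]}) :
  (forall t, same_lowest (d t) (F t) (G t)) ->
  same_lowest (\sum_t d t) (\prod_t F t) (\prod_t G t).
Proof.
move=> h; rewrite -big_enum -[\prod_t F t]big_enum -[\prod_t G t]big_enum /=.
elim: (enum T) => [|t s IHs]; first by rewrite !big_nil; apply: same_lowest1.
by rewrite !big_cons; apply: same_lowestM.
Qed.

(** Elements of the form [X_l + O(2)] are algebraically independent: a relation
    between them has the same component of lowest degree as the relation between
    the [X_l] with the same coefficients. *)
Lemma alg_independent N (g : 'I_N -> {mpoly K[n]}) (w : 'I_N -> 'I_n) k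
    (c : {ffun 'I_N -> 'I_k} -> K) q0 :
  injective w -> (forall l, same_lowest 1 (g l) 'X_(w l)) -> c q0 != 0 ->
  \sum_q c q *: \prod_l g l ^+ q l != 0.
Proof.
move=> w_inj gX cq0.
pose dg (q : {ffun 'I_N -> 'I_k}) := (\sum_l q l)%N.
pose mon (q : {ffun 'I_N -> 'I_k}) : 'X_{1..n} := (\sum_l U_(w l) *+ q l)%MM.
have mon_w q l : mon q (w l) = q l.
  rewrite mnm_sumE (bigD1 l) //= mulmnE mnm1E eqxx mul1n big1 ?addn0 //.
  by move=> i il; rewrite mulmnE mnm1E (inj_eq w_inj) (negPf il) mul0n.
have mon_inj q q' : mon q = mon q' -> q = q'.
  by move=> e; apply/ffunP => l; apply: val_inj; rewrite /= -mon_w e mon_w.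
have mdeg_mon q : mdeg (mon q) = dg q.
  by rewrite mdeg_sum; apply: eq_bigr => l _; rewrite mdegMn mdeg1 mul1n.
have lowq q : same_lowest (dg q) (\prod_l g l ^+ q l) 'X_[mon q].
  have -> : 'X_[mon q] = \prod_l 'X_(w l) ^+ q l :> {mpoly K[n]}.
    by rewrite /mon -mprodXnE.
  rewrite /dg; under eq_bigr do rewrite -[nat_of_ord _]mul1n.
  by apply: same_lowest_prod => l; apply: same_lowestX.
pose q1 := [arg min_(q < q0 | c q != 0) dg q].
have [cq1 q1_min] : c q1 != 0 /\ forall q, c q != 0 -> (dg q1 <= dg q)%N.
  by rewrite /q1; case: arg_minnP => // q qS qmin; split.
apply/eqP => /(congr1 (mcoeff (mon q1))); rewrite mcoeff0 raddf_sum /=.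
rewrite (bigD1 q1) //= [X in _ + X]big1 ?addr0 => [|q qq1].
  have [_ /(_ (mon q1))] := lowq q1; rewrite mdeg_mon ltnSn mcoeffB => /(_ isT).
  move/eqP; rewrite subr_eq0 mcoeffX eqxx mcoeffZ => /eqP->; rewrite mulr1.
  by apply/eqP.
have [cq|] := eqVneq (c q) 0; first by rewrite cq scale0r mcoeff0.
move=> /q1_min le_q; have [_ /(_ (mon q1))] := lowq q.
rewrite mdeg_mon ltnS mcoeffB => /(_ le_q)/eqP; rewrite subr_eq0 mcoeffX mcoeffZ.
rewrite (_ : mon q == mon q1 = false) => [/eqP->|]; first by rewrite mulr0.
by apply: contraNF qq1 => /eqP/mon_inj ->.
Qed.

End Order.

(** The first two terms of the Taylor expansion of a substitution. *)
Lemma mmap_low (K : fieldType) n n' (h : 'I_n -> {mpoly K[n']}) F :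
  (forall i, ord_ge 1 (h i)) ->
  ord_ge 2 (mmap (@mpolyC n' K) h F - (F@_0%MM)%:MP
            - \sum_i F@_U_(i)%MM *: h i).
Proof.
move=> h1; elim/mpolyind: F => [|c m F _ _ IHF].
  rewrite raddf0 mcoeff0 mpolyC0 subr0 sub0r big1 ?oppr0 => [|i _].
    exact: ord_ge0.
  by rewrite mcoeff0 scale0r.
pose L G := mmap (@mpolyC n' K) h G - (G@_0%MM)%:MP - \sum_i G@_U_(i)%MM *: h i.
have LD G H : L (G + H) = L G + L H.
  rewrite /L raddfD /= mcoeffD mpolyCD.
  under eq_bigr do rewrite mcoeffD scalerDl.
  by rewrite big_split /=; ring.
have LZ d G : L (d *: G) = d *: L G.
  rewrite /L mmapZ /= mul_mpolyC mcoeffZ mpolyCM mul_mpolyC !scalerBr.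
  by congr (_ - _ - _); rewrite scaler_sumr; apply: eq_bigr => i _; rewrite mcoeffZ scalerA.
rewrite -/(L _) LD LZ; apply: ord_geD => //; apply: ord_geZ.
rewrite /L mmapX; under eq_bigr do rewrite mcoeffX.
have [m1|] := boolP (mdeg m == 1%N).
  move: m1 => /mdeg1P[j /eqP ->]; rewrite mmap1U mcoeffX mnm1_eq0 mpolyC0 subr0.
  rewrite (bigD1 j) //= eqxx scale1r big1 ?addr0 ?subrr; first exact: ord_ge0.
  by move=> i ij; rewrite eq_mnm1 eq_sym (negPf ij) scale0r.
move=> m1; rewrite [X in _ - X]big1 ?subr0 => [|i _]; last first.
  case: eqP => [mi|_]; last by rewrite scale0r.
  by rewrite mi mdeg1 in m1.
have [->|m0] := eqVneq m 0%MM; first by rewrite mmap11 mcoeffX eqxx subrr; apply: ord_ge0.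
rewrite mcoeffX (negPf m0) mpolyC0 subr0.
have m2 : (2 <= mdeg m)%N by move: m0 m1; rewrite -mdeg_eq0; lia.
apply: ord_geW m2 _; rewrite mdegE /mmap1.
have hX i : ord_ge (m i) (h i ^+ m i).
  by rewrite -[X in ord_ge X _]mul1n; apply: ord_geX.
rewrite -big_enum -[\prod_(i < n) _]big_enum /=.
elim: (enum _) => [|i s IHs]; first by rewrite !big_nil.
by rewrite !big_cons; apply: ord_geM.
Qed.

Section ChainOfParametrization.

Variables (K : fieldType) (I : finType) (Z : {ffun I -> K^o} -> Prop).
Variables (r : nat) (phi : I -> {mpoly K[r]}) (lam : 'I_r.+1 -> I -> K).

Hypothesis phiZ : forall e F, F \is e.-homog -> vanishes_on F Z ->
  ev (@mpolyC r K) phi F = 0.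
Hypothesis lam_value : forall i,
  \sum_a lam i a * (phi a)@_0%MM = (i == ord0)%:R.
Hypothesis lam_diff : forall i l,
  \sum_a lam i a * (phi a)@_U_(l)%MM = (i == lift ord0 l)%:R.

Local Notation R := {mpoly K[#|I|]}.
Local Notation B := {mpoly K[r.+1]}.

(** One more variable, of index 0, accounts for the homotheties: the affine cone
    is parametrized by [(1 + X_0) * phi].  The shift by 1 puts the base point at
    the origin of the parameter space. *)
Definition shift_vars : {mpoly K[r]} -> B :=
  mmap (@mpolyC r.+1 K) (fun l => 'X_(lift ord0 l)).
HB.instance Definition _ := GRing.RMorphism.copy shift_vars
  (mmap (@mpolyC r.+1 K) (fun l : 'I_r => 'X_(lift ord0 l))).

Definition restrict_var j (l : 'I_r.+1) : {mpoly K[j]} :=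
  if insub (l : nat) is Some l' then 'X_l' else 0.
Definition restrict_vars j : B -> {mpoly K[j]} :=
  mmap (@mpolyC j K) (restrict_var j).
HB.instance Definition _ j := GRing.RMorphism.copy (@restrict_vars j)
  (mmap (@mpolyC j K) (restrict_var j)).

Definition extend_vars j : {mpoly K[j]} -> B :=
  mmap (@mpolyC r.+1 K) (fun l : 'I_j => 'X_(inord l)).
HB.instance Definition _ j := GRing.RMorphism.copy (@extend_vars j)
  (mmap (@mpolyC r.+1 K) (fun l : 'I_j => 'X_(inord l))).

(** Specialization to 0 of the variables of index at least [j]. *)
Definition truncate j : B -> B := @extend_vars j \o restrict_vars j.
HB.instance Definition _ j := GRing.RMorphism.on (truncate j).

Lemma truncateC j c : truncate j c%:MP = c%:MP.
Proof. by rewrite /truncate /= /restrict_vars mmapC /= /extend_vars mmapC. Qed.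

Lemma truncateX j l : truncate j 'X_l = if (l < j)%N then 'X_l else 0.
Proof.
rewrite /truncate /= /restrict_vars mmapX mmap1U /restrict_var; case: insubP => [l' -> ll'|].
  rewrite /extend_vars mmapX mmap1U; congr ('X_ _).
  by rewrite ll' inord_val.
by move=> /negPf ->; rewrite raddf0.
Qed.

Lemma truncate_truncate j j' F :
  (j' <= j)%N -> truncate j' (truncate j F) = truncate j' F.
Proof.
move=> le_j.
have E (g : {rmorphism B -> B}) : (forall c, g c%:MP = c%:MP) ->
    g F = mmap (@mpolyC r.+1 K) (fun l => g 'X_l) F.
  move=> gC; rewrite -[in LHS](comp_mpoly_id F) /comp_mpoly.
  rewrite (rmorph_mmap (h := @mpolyC r.+1 K)) //.
  by apply: eq_mmap => l; rewrite tnth_mktuple.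
have gC c : (truncate j' \o truncate j) c%:MP = c%:MP by rewrite /= !truncateC.
have gX l : (truncate j' \o truncate j) 'X_l = truncate j' 'X_l.
  rewrite -[LHS]/(truncate j' (truncate j 'X_l)) truncateX.
  have [//|jl] := ltnP l j.
  by rewrite raddf0 truncateX ltnNge (leq_trans le_j jl).
apply: etrans (E (truncate j' \o truncate j) gC) _.
apply: etrans (esym (E (truncate j') (truncateC j'))).
exact: eq_mmap.
Qed.

Definition cone a : B := (1 + 'X_ord0) * shift_vars (phi a).

Definition cone_ev j : R -> B := ev (@mpolyC r.+1 K) (fun a => truncate j (cone a)).
HB.instance Definition _ j := GRing.RMorphism.copy (cone_ev j)
  (ev (@mpolyC r.+1 K) (fun a => truncate j (cone a))).

Lemma cone_evE j F :
  cone_ev j F = truncate j (ev (@mpolyC r.+1 K) cone F).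
Proof.
rewrite /cone_ev (ev_comp (g := truncate j) (h := @mpolyC r.+1 K)) //.
exact: truncateC.
Qed.

Lemma cone_ev_vanish j e F :
  F \is e.-homog -> vanishes_on F Z -> cone_ev j F = 0.
Proof.
move=> hF FZ; rewrite cone_evE [ev _ _ F](_ : _ = 0) ?raddf0 //.
rewrite (ev_homog _ _ _ hF) -(ev_comp (f := @mpolyC r K)) => [|c]; last first.
  by rewrite /= /shift_vars mmapC.
by rewrite (phiZ hF FZ) raddf0 mulr0.
Qed.

(** The homothety of ratio ['X], in terms of the parameters: it commutes with
    [truncate], so that the kernels of the maps [cone_ev] are homogeneous. *)
Definition homothety : B -> {poly B} :=
  mmap (polyC \o @mpolyC r.+1 K)
    (fun l => if l == ord0 then 'X * (1 + 'X_ord0)%:P - 1 else ('X_l)%:P).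
HB.instance Definition _ := GRing.RMorphism.copy homothety
  (mmap (polyC \o @mpolyC r.+1 K) (fun l : 'I_r.+1 =>
    if l == ord0 then 'X * (1 + 'X_ord0)%:P - 1 else ('X_l)%:P)).

Lemma homothety_cone j a : (0 < j)%N ->
  homothety (truncate j (cone a)) = 'X^1 * (truncate j (cone a))%:P.
Proof.
move=> j_gt0; rewrite /cone !rmorphM !rmorphD !rmorph1 /= truncateX j_gt0.
rewrite {1}/homothety mmapX mmap1U eqxx addrC subrK expr1 -mulrA.
rewrite polyCD; congr (_ * (_ * _)).
rewrite /shift_vars (rmorph_mmap (h := @mpolyC r.+1 K)); last exact: truncateC.
rewrite (rmorph_mmap (h := polyC \o @mpolyC r.+1 K)) => [|c]; last first.
  by rewrite /= /homothety mmapC.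
rewrite [RHS](rmorph_mmap (g := polyC) (h := polyC \o @mpolyC r.+1 K)) //.
apply: eq_mmap => l; rewrite /= truncateX; case: ifP => _; last by rewrite !raddf0.
by rewrite /homothety mmapX mmap1U.
Qed.

Lemma cone_ev_homog j e F : (0 < j)%N ->
  cone_ev j F = 0 -> cone_ev j (pihomog mdeg e F) = 0.
Proof.
move=> j_gt0 F0; apply: (@ev_scale_eq0 _ _ _ _ 1 (polyC \o @mpolyC r.+1 K)) => //.
rewrite -(rmorph0 homothety) -F0 /cone_ev (ev_comp (h := polyC \o @mpolyC r.+1 K)).
  by apply: eq_ev => a; rewrite -homothety_cone.
by move=> c; rewrite /= /homothety mmapC.
Qed.

(** Polynomial functions dual, to first order, to the parameters. *)
Definition dual_coord l : R :=
  \sum_a lam l a *: 'X_(enum_rank a) - (l == ord0)%:R%:MP.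

Lemma cone_ev_dual_coord j (l : 'I_r.+1) :
  (l < j)%N -> same_lowest 1 (cone_ev j (dual_coord l)) 'X_l.
Proof.
move=> lj; split; first exact: ord_ge_var.
have low1 i : ord_ge 1 (truncate j 'X_i).
  rewrite truncateX; case: ifP => _; first exact: ord_ge_var.
  exact: ord_ge0.
pose X i := truncate j 'X_i.
have Tphi a : exists2 Q, ord_ge 2 Q &
    truncate j (cone a) = (1 + X ord0) * (((phi a)@_0%MM)%:MP
      + \sum_i (phi a)@_U_(i)%MM *: X (lift ord0 i) + Q).
  have := mmap_low (phi a) (fun i => low1 (lift ord0 i)).
  set Q := (X in ord_ge 2 X) => Q2; exists Q => //.
  rewrite /cone !rmorphM rmorphD rmorph1 /=; congr (_ * _).
  rewrite [truncate j _](_ : _ = mmap (@mpolyC r.+1 K)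
    (fun i => truncate j 'X_(lift ord0 i)) (phi a)).
    by rewrite /Q; ring.
  by rewrite /shift_vars (rmorph_mmap (h := @mpolyC r.+1 K)) //; exact: truncateC.
have [Q Q2 QE] : exists2 Q, forall a, ord_ge 2 (Q a) & forall a,
    truncate j (cone a) = (1 + X ord0) * (((phi a)@_0%MM)%:MP
      + \sum_i (phi a)@_U_(i)%MM *: X (lift ord0 i) + Q a).
  have [a|Q hQ] := @fin_all_exists _ (fun=> B) (fun a Q => ord_ge 2 Q /\
     truncate j (cone a) = (1 + X ord0) * (((phi a)@_0%MM)%:MP
      + \sum_i (phi a)@_U_(i)%MM *: X (lift ord0 i) + Q)).
    by have [Q] := Tphi a; exists Q.
  by exists Q => a; have [] := hQ a.
rewrite /cone_ev /dual_coord raddfB /= evC raddf_sum /=.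
under eq_bigr do rewrite evZ evX QE mulrCA.
rewrite -mulr_sumr.
under eq_bigr => a _ do rewrite mul_mpolyC !scalerDr scaler_sumr.
rewrite !big_split /= exchange_big /=.
have -> : \sum_a lam l a *: ((phi a)@_0%MM)%:MP = (l == ord0)%:R%:MP :> B.
  rewrite -lam_value raddf_sum; apply: eq_bigr => a _ /=.
  by rewrite mpolyCM mul_mpolyC.
have -> : \sum_i \sum_a lam l a *: ((phi a)@_U_(i)%MM *: X (lift ord0 i)) =
    \sum_i (l == lift ord0 i)%:R *: X (lift ord0 i).
  apply: eq_bigr => i _; rewrite -lam_diff scaler_suml; apply: eq_bigr => a _.
  by rewrite scalerA.
set S := \sum_a lam l a *: Q a; have S2 : ord_ge 2 S.
  by apply: ord_ge_sum => a _; apply: ord_geZ; apply: Q2.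
have low1X i : ord_ge 1 (X i) by exact: low1.
have S2' : ord_ge 2 ((1 + X ord0) * S).
  rewrite mulrDl mul1r; apply: ord_geD => //.
  by apply: (@ord_geW _ _ 3) => //; apply: (@ord_geM _ _ 1 2).
case: (unliftP ord0 l) lj => [i|] -> lj.
  rewrite (bigD1 i) //= eqxx scale1r big1 => [|i' i'i]; last first.
    by rewrite (inj_eq (@lift_inj _ _)) eq_sym (negPf i'i) scale0r.
  rewrite mpolyC0 add0r addr0 subr0 mulrDr.
  have -> : X (lift ord0 i) = 'X_(lift ord0 i) by rewrite /X truncateX lj.
  rewrite addrAC; apply: ord_geD => //; rewrite mulrDl mul1r addrAC subrr add0r.
  by apply: (@ord_geM _ _ 1 1) => //; exact: ord_ge_var.
rewrite eqxx mpolyC1 big1 ?addr0 => [|i _]; last by rewrite scale0r.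
have -> : X ord0 = 'X_ord0 by rewrite /X truncateX lj.
rewrite mulrDr mulr1 -/(X ord0).
rewrite (_ : _ - _ = (1 + 'X_ord0) * S); last by ring.
by move: S2'; rewrite /X truncateX lj.
Qed.

(** The chain of the closures of the images of smaller and smaller coordinate
    subspaces of the parameter space.  Two consecutive ones are distinguished
    by an algebraic relation between the first dual coordinates. *)
Lemma prime_chain_of_parametrization : has_prime_chain Z r.
Proof.
pose J (i : 'I_r.+1) := (r.+1 - i)%N.
have J0 i : (0 < J i)%N by rewrite subn_gt0.
exists (fun i F => cone_ev (J i) F = 0); split.
- move=> i; split.
  + exact: raddf0.
  + by move=> F G F0 G0; rewrite raddfD /= F0 G0 addr0.
  + by move=> F G G0; rewrite rmorphM /= G0 mulr0.
  + by move=> e F; apply: cone_ev_homog.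
  + by move=> F G /eqP; rewrite rmorphM mulf_eq0 => /orP[]/eqP; [left|right].
  + have [_ low] := cone_ev_dual_coord (J0 i : (@ord0 r < _)%N).
    have [/forallP X0|/forallPn[v Xv]] :=
        boolP [forall v, cone_ev (J i) 'X_v == 0]; last first.
      by exists v; apply/eqP.
    have := low U_(ord0)%MM; rewrite mdeg1 => /(_ isT)/eqP.
    rewrite mcoeffB mcoeffX eqxx /dual_coord raddfB raddf_sum /= big1.
      by rewrite /cone_ev evC sub0r mcoeffN mcoeffC mnm1_eq0 mulr0 oppr0 sub0r oppr_eq0 oner_eq0.
    by move=> a _; rewrite /cone_ev evZ -/(cone_ev _ _) (eqP (X0 _)) mulr0.
- by move=> i c F; apply: cone_ev_vanish.
- move=> i i' lt_i; have lt_J : (J i' < J i)%N by rewrite ltn_sub2l // ltnW.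
  split=> [F|].
    by rewrite !cone_evE => F0; rewrite -(truncate_truncate _ (ltnW lt_J)) F0 raddf0.
  have ltr (l : 'I_(J i').+1) : (l < r.+1)%N.
    by apply: leq_trans (leq_trans lt_J (leq_subr _ _)).
  pose w l := Ordinal (ltr l); pose f l := dual_coord (w l).
  have [k [c [[q0 cq0] cf]]] := alg_dependent
    (fun l => restrict_vars (J i') (ev (@mpolyC r.+1 K) cone (f l))).
  exists (\sum_q c q *: \prod_l f l ^+ q l); split.
    rewrite cone_evE /truncate /= (_ : restrict_vars _ _ = 0) ?raddf0 //.
    rewrite -[RHS]cf [ev _ _ _]raddf_sum /= raddf_sum; apply: eq_bigr => q _ /=.
    rewrite evZ rmorphM /= [restrict_vars _ _%:MP]mmapC /= mul_mpolyC.
    by rewrite !rmorph_prod; congr (_ *: _); apply: eq_bigr => l _; rewrite !rmorphXn.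
  apply/eqP; rewrite [X in X != 0](_ : _ =
      \sum_q c q *: \prod_l (cone_ev (J i) (f l)) ^+ q l).
    apply: (alg_independent (w := w)) cq0.
      by move=> l l' /(congr1 (@nat_of_ord _)) ll'; apply: ord_inj.
    by move=> l; apply: cone_ev_dual_coord; exact: leq_trans (ltn_ord l) lt_J.
  rewrite raddf_sum; apply: eq_bigr => q _ /=.
  rewrite /cone_ev evZ -/(cone_ev _ _) mul_mpolyC; congr (_ *: _).
  by rewrite rmorph_prod; apply: eq_bigr => l _; rewrite rmorphXn.
Qed.

End ChainOfParametrization.

(** * Polynomials over an infinite field *)

Lemma pchar0_natr_inj (K : fieldType) : [pchar K] =i pred0 ->
  injective (fun n => n%:R : K).
Proof.
move=> charK0 m n /= /eqP; wlog le_mn : m n / (m <= n)%N => [IH e|].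
  case: (leqP m n) => [/IH|/ltnW/IH H]; first exact.
  by apply/esym/H; rewrite eq_sym.
rewrite eq_sym -subr_eq0 -natrB // ((pcharf0P K).1 charK0) subn_eq0 => le_nm.
by apply/eqP; rewrite eqn_leq le_mn.
Qed.

Lemma poly_vanish_eq0 (K : fieldType) (p : {poly K}) :
  [pchar K] =i pred0 -> (forall x, p.[x] = 0) -> p = 0.
Proof.
move=> charK0 p0; apply/eqP/negPn/negP => pN0.
have := @max_poly_roots K p [seq i%:R | i <- iota 0 (size p)] pN0.
rewrite size_map size_iota ltnn => H; suff: false by []; apply: H.
  by apply/allP => x _; apply/eqP.
by rewrite map_inj_uniq ?iota_uniq //; apply: pchar0_natr_inj.
Qed.

Lemma mpoly_vanish_eq0 (K : fieldType) n (p : {mpoly K[n]}) :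
  [pchar K] =i pred0 -> (forall v, p.@[v] = 0) -> p = 0.
Proof.
move=> charK0; elim: n p => [|n IHn] p p0.
  by have := p0 (fun=> 0); rewrite [p]nvar0_mpolyC mevalC => ->; rewrite mpolyC0.
pose X i : {poly {mpoly K[n]}} :=
  if unlift ord_max i is Some j then ('X_j)%:P else 'X.
pose s := mmap (polyC \o @mpolyC n K) X p.
suff s0 : s = 0.
  pose g : {rmorphism {poly {mpoly K[n]}} -> {mpoly K[n.+1]}} :=
    horner_eval ('X_ord_max : {mpoly K[n.+1]})
              \o map_poly (mmap (@mpolyC n.+1 K) (fun i => 'X_(lift ord_max i))).
  have : g s = p.
    rewrite /s (rmorph_mmap (h := @mpolyC n.+1 K)) => [|c]; last first.
      by rewrite /= map_polyC /= mmapC /horner_eval hornerC.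
    rewrite -[RHS]comp_mpoly_id /comp_mpoly /mmap; apply: eq_bigr => m _.
    congr (_ * _); apply: eq_bigr => i _; rewrite tnth_mktuple; congr (_ ^+ _).
    rewrite /= /X; case: unliftP => [j|] ->.
      by rewrite map_polyC /= mmapX mmap1U /horner_eval hornerC.
    by rewrite map_polyX /horner_eval hornerX.
  by rewrite s0 raddf0.
apply/polyP => k; rewrite coef0; apply: IHn => v.
suff : map_poly (meval v) s = 0.
  by move/(congr1 (fun q : {poly K} => q`_k)); rewrite coef_map coef0.
apply: poly_vanish_eq0 => // x.
pose g : {rmorphism {poly {mpoly K[n]}} -> K} :=
  horner_eval x \o map_poly (meval v).
rewrite -[LHS]/(g s) /s (rmorph_mmap (h := idfun)) => [|c]; last first.
  by rewrite /= map_polyC /= mevalC /horner_eval hornerC.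
exact: p0.
Qed.

(** * Tangent spaces and secant varieties *)

Section FunctionSpace.

Variables (K : fieldType) (I : finType).

Definition delta (a : I) : {ffun I -> K^o} := [ffun b => (a == b)%:R].

Lemma ffun_delta (w : {ffun I -> K^o}) : w = \sum_a w a *: delta a.
Proof.
apply/ffunP => b; rewrite sum_ffunE (bigD1 b) //= !ffunE eqxx big1 ?addr0.
  by rewrite /GRing.scale /= mulr1.
by move=> a ab; rewrite !ffunE (negPf ab) scaler0.
Qed.

Lemma linear_delta (f : {linear {ffun I -> K^o} -> K^o}) w :
  f w = \sum_a f (delta a) * w a.
Proof.
rewrite [in LHS](ffun_delta w) linear_sum; apply: eq_bigr => a _.
by rewrite linearZ /= mulrC.
Qed.

End FunctionSpace.

(** The Leibniz rule, at the origin. *)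
Lemma mcoeff_prod_linear (K : fieldType) n (T : finType)
    (F : T -> {mpoly K[n]}) l :
  (\prod_t F t)@_U_(l)%MM =
  \sum_t (F t)@_U_(l)%MM * \prod_(t' | t' != t) (F t')@_0%MM.
Proof.
have mcU (G H : {mpoly K[n]}) : (G * H)@_U_(l)%MM =
    G@_U_(l)%MM * H@_0%MM + G@_0%MM * H@_U_(l)%MM.
  have E (p : {mpoly K[n]}) : p@_U_(l)%MM = (p^`M(l))@_0%MM.
    by rewrite mcoeff_deriv add0m mnm0E.
  by rewrite !E mderivM mcoeffD -!/(mcoeff 0%MM _) !(rmorphM (mcoeff 0%MM)).
rewrite -big_enum [RHS](eq_bigr (fun t => (F t)@_U_(l)%MM *
  \prod_(t' <- enum T | t' != t) (F t')@_0%MM)) => [|t _]; last first.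
  by rewrite big_enum_cond.
rewrite -[RHS]big_enum /=; elim: (enum T) (enum_uniq T) => [|t s IHs] /=.
  by move=> _; rewrite !big_nil mcoeff1 mnm1_eq0.
move=> /andP[ts us]; rewrite !big_cons mcU IHs // eqxx /=; congr (_ * _ + _).
  rewrite rmorph_prod /= big_seq [RHS]big_seq_cond; apply: eq_bigl => t'.
  by case: eqP => [->|_]; rewrite ?andbT // andbF (negPf ts).
rewrite mulr_sumr big_seq [RHS]big_seq; apply: eq_bigr => t' t's.
rewrite big_cons ifT; first exact: mulrCA.
by apply: contraNneq ts => ->.
Qed.

Section TangentSpaces.

Variables (K : fieldType) (k : nat) (d : k.-tuple nat).
Local Notation fac := (factors K d).
Local Notation tspace := (tensor_space K d).

Lemma tens_eq0 (v : fac) i : v i = 0 -> tens v = 0.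
Proof.
move=> v0; apply/ffunP => a; rewrite !ffunE (bigD1 i) //= v0 mxE mul0r //.
Qed.

Lemma tens_subst_id (v : fac) i : tens_subst v (v i) = tens v.
Proof.
apply/ffunP => a; rewrite !ffunE; apply: eq_bigr => j _.
have [<-|ij] := eqVneq i j; first by rewrite dfwith_in.
by rewrite dfwith_out.
Qed.

Lemma tens_substE (v : fac) i (x : 'rV_(tnth d i).+1) a :
  tens_subst v x a = x 0 (a i) * \prod_(j | j != i) v j 0 (a j).
Proof.
rewrite ffunE (bigD1 i) //= dfwith_in; congr (_ * _).
by apply: eq_bigr => j ji; rewrite dfwith_out // eq_sym.
Qed.

Lemma mem_tangent (v : fac) i (x : 'rV_(tnth d i).+1) :
  tens_subst v x \in tangent_space v.
Proof.
rewrite -[tens_subst v x]lfunE; apply: (subvP (sumv_sup i isT (subvv _))).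
by apply: memv_img; apply: memvf.
Qed.

Lemma tens_tangent (i : 'I_k) (v : fac) : tens v \in tangent_space v.
Proof. by rewrite -(tens_subst_id v i) mem_tangent. Qed.

(** A tensor with a zero factor is zero, hence in the span of any point. *)
Lemma secant_sum s (u : 'I_s -> fac) w :
  w = \sum_j tens (u j) -> w != 0 -> segre_secant K d s w.
Proof.
move=> ew w0; split=> // e F _; apply; split=> //.
pose ones : fac := fun i => const_mx 1.
pose u' j := if [forall i, u j i != 0] then u j else ones.
exists (fun j => tens (u' j)); split=> [j|].
  exists (u' j) => // i; rewrite /u'; case: ifP => [/forallP //|_].
  by apply/rV0Pn; exists ord0; rewrite mxE oner_neq0.
rewrite ew; apply: memv_sumr => j _; rewrite /u'.
case: ifP => [_|/forallPn[i]]; first exact: memv_line.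
by rewrite negbK => /eqP/tens_eq0 ->; exact: mem0v.
Qed.

(** The sum is not always a secant point, as it may be zero; the nonzero secant
    point given by [u0] settles this case, by homogeneity. *)
Lemma secant_form_vanish s e F (u0 u : 'I_s -> fac) :
  \sum_j tens (u0 j) != 0 ->
  F \is e.-homog -> vanishes_on F (segre_secant K d s) ->
  eval_at F (\sum_j tens (u j)) = 0.
Proof.
move=> u0N0 hF FZ; have [->|uN0] := eqVneq (\sum_j tens (u j)) 0; last first.
  exact/FZ/(secant_sum (u := u)).
rewrite -[LHS]/(ev idfun (0 : {ffun _ -> K^o}) F).
rewrite (@eq_ev _ _ _ _ _ (fun a => 0 * (\sum_j tens (u0 j)) a)).
  apply: etrans (ev_homog idfun (\sum_j tens (u0 j) : tspace) 0 hF) _.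
  apply/eqP; rewrite mulf_eq0; apply/orP; right.
  exact/eqP/FZ/(secant_sum (u := u0)).
by move=> a; rewrite ffunE mul0r.
Qed.

(** Terracini's lemma, as a lower bound of the dimension: the sum of the tangent
    spaces is the image of the differential of the parametrization of the
    secant variety by [s] points of the Segre variety, and the parameters can be
    restricted to a subspace on which this differential is injective. *)
Lemma prime_chain_of_tangent_spaces s (v : 'I_s -> fac) (i0 : 'I_k) r :
  [pchar K] =i pred0 -> \sum_j tens (v j) != 0 ->
  (r < \dim (\sum_j tangent_space (v j)))%N ->
  has_prime_chain (segre_secant K d s) r.
Proof.
move=> charK0; set w0 := \sum_j _ => w0N0; set U := (\sum_j _)%VS => r_lt.
have w0U : w0 \in U by apply: memv_sumr => j _; exact: tens_tangent i0 _.
pose U' := (U :\: <[w0]>)%VS; pose D := \dim U'.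
pose e := [tuple of w0 :: vbasis U'].
have D_ge : (r.+1 <= D.+1)%N.
  rewrite ltnS -ltnS (leq_trans r_lt) // -(dimv_cap_compl U <[w0]>) -/D.
  rewrite [(U :&: _)%VS](_ : _ = <[w0]>%VS) ?dim_vline ?w0N0 ?add1n //.
  by apply/capv_idPr; rewrite -memvE.
have eU i : e`_i \in U.
  case: i => [|i] /=; first exact: w0U.
  have [i_lt|i_ge] := ltnP i (size (vbasis U')); last first.
    by rewrite nth_default // mem0v.
  by apply: (subvP (diffvSl U <[w0]>)); apply: vbasis_mem; apply: mem_nth.
have e_free : free e.
  rewrite free_cons (basis_free (vbasisP _)) andbT (span_basis (vbasisP _)).
  apply: contra w0N0 => w0U'; rewrite -memv0 -(capv_diff U <[w0]>).
  by apply/memv_capP; split=> //; exact: memv_line.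
have [x xE] : exists x : 'I_r -> 'I_s -> fac, forall l : 'I_r,
    e`_l.+1 = \sum_j \sum_i tens_subst (v j) (x l j i).
  apply: (@fin_all_exists _ (fun=> 'I_s -> fac) (fun (l : 'I_r) (x : 'I_s -> fac) =>
    e`_l.+1 = \sum_j \sum_i tens_subst (v j) (x j i))) => l.
  have /memv_sumP[u uT ->] := eU l.+1.
  have [j|x xE] := @fin_all_exists _ (fun=> fac) (fun (j : 'I_s) (x : fac) =>
    u j = \sum_i tens_subst (v j) (x i)).
    exact/tangent_spaceP/uT.
  by exists x; apply: eq_bigr.
pose f j i (b : 'I_(tnth d i).+1) : {mpoly K[r]} :=
  (v j i 0 b)%:MP + \sum_l x l j i 0 b *: 'X_l.
have f0 j i b : (f j i b)@_0%MM = v j i 0 b.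
  rewrite /f mcoeffD mcoeffC eqxx mulr1 raddf_sum big1 ?addr0 // => l _.
  by rewrite /= mcoeffZ mcoeffX mnm1_eq0 mulr0.
have fU j i b l : (f j i b)@_U_(l)%MM = x l j i 0 b.
  rewrite /f mcoeffD mcoeffC mnm1_eq0 mulr0 add0r raddf_sum (bigD1 l) //=.
  rewrite mcoeffZ mcoeffX eqxx mulr1 big1 ?addr0 // => l' l'l.
  by rewrite mcoeffZ mcoeffX eq_mnm1 (negPf l'l) mulr0.
pose phi (a : multi_index d) := \sum_j \prod_i f j i (a i).
have phi0 a : (phi a)@_0%MM = e`_0 a.
  rewrite raddf_sum /= sum_ffunE; apply: eq_bigr => j _.
  by rewrite rmorph_prod ffunE; apply: eq_bigr => i _; exact: f0.
have phiU a l : (phi a)@_U_(l)%MM = e`_l.+1 a.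
  rewrite raddf_sum xE sum_ffunE; apply: eq_bigr => j _ /=.
  rewrite mcoeff_prod_linear sum_ffunE; apply: eq_bigr => i _.
  rewrite tens_substE fU; congr (_ * _); apply: eq_bigr => j' _; exact: f0.
pose lam i a : K := coord e (widen_ord D_ge i) (delta K a).
have lamE i (w : tspace) : \sum_a lam i a * w a = coord e (widen_ord D_ge i) w.
  exact/esym/(@linear_delta K (multi_index d) (coord e (widen_ord D_ge i)) w).
apply: (@prime_chain_of_parametrization K _ _ r phi lam).
- move=> c F hF FZ; apply: mpoly_vanish_eq0 => // y.
  rewrite (ev_comp (g := meval y) (h := idfun)) => [|z]; last exact: mevalC.
  pose u j : fac := fun i => v j i + \sum_l y l *: x l j i.
  rewrite (@eq_ev _ _ _ _ _ (\sum_j tens (u j))).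
    exact: (secant_form_vanish u w0N0 hF FZ).
  move=> a; rewrite sum_ffunE /phi raddf_sum; apply: eq_bigr => j _.
  rewrite ffunE /= rmorph_prod.
  apply: eq_bigr => i _ /=.
  rewrite /f /u mevalD mevalC mxE summxE raddf_sum; congr (_ + _).
  by apply: eq_bigr => l _; rewrite /= mevalZ mevalXU mxE mulrC.
- move=> i; under eq_bigr do rewrite phi0.
  by rewrite lamE -[e`_0]/(e`_(widen_ord D_ge ord0)) coord_free // eq_sym.
- move=> i l; under eq_bigr do rewrite phiU.
  by rewrite lamE -[e`_l.+1]/(e`_(widen_ord D_ge (lift ord0 l))) coord_free // eq_sym.
Qed.

End TangentSpaces.

(** * Semicontinuity of the span of the tangent spaces *)

Lemma free_subseq (K : fieldType) (vT : vectType K) (s : seq vT) :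
  exists t, [/\ subseq t s, free t & <<t>>%VS = <<s>>%VS].
Proof.
elim: s => [|v s [t [ts t_free t_span]]]; first by exists [::]; rewrite nil_free.
have [vt|vt] := boolP (v \in <<t>>%VS).
  exists t; split=> //; first by rewrite (subseq_trans ts) // subseq_cons.
  rewrite span_cons -t_span; apply/esym/eqP.
  by rewrite eqEsubv addvSr subv_add subvv -memvE vt.
exists (v :: t); split; first by rewrite /= eqxx.
  by rewrite free_cons vt.
by rewrite !span_cons t_span.
Qed.

Lemma dim_ffun (K : fieldType) (I : finType) : dim {ffun I -> K^o} = #|I|.
Proof. by rewrite /dim /= [dim _](erefl : _ = 1%N) muln1. Qed.

Section Minors.

Variables (K : fieldType) (I : finType).
Local Notation vec := {ffun I -> K^o}.

Lemma leq_dim_minor r (U : {vspace vec}) (w : 'I_r -> vec) (a : 'I_r -> I) :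
  (forall p, w p \in U) -> \det (\matrix_(p, q) w p (a q)) != 0 ->
  (r <= \dim U)%N.
Proof.
move=> wU detw; pose X := [tuple w p | p < r].
have : free X.
  apply/freeP => c cX p; pose u := \row_p c p.
  suff : u = 0 by move/rowP/(_ p); rewrite !mxE.
  have uM : u *m (\matrix_(p, q) w p (a q)) = 0.
    apply/rowP => q; rewrite !mxE.
    move/ffunP/(_ (a q)): cX; rewrite sum_ffunE ffunE => cX.
    rewrite -[RHS]cX; apply: eq_bigr => i _.
    by rewrite !mxE ffunE -tnth_nth tnth_mktuple.
  have uniM : (\matrix_(p, q) w p (a q)) \in unitmx by rewrite unitmxE unitfE.
  by rewrite -[u](mulmxK uniM) uM mul0mx.
rewrite /free size_tuple => /eqP <-; apply: dimvS; apply/span_subvP => x.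
by move=> /mapP[p _ ->].
Qed.

Lemma minor_of_dim r (G : finType) (U : {vspace vec}) (w : G -> vec) :
  (U <= <<[seq w g | g : G]>>)%VS -> (r <= \dim U)%N ->
  exists (g : 'I_r -> G) (a : 'I_r -> I),
    \det (\matrix_(p, q) w (g p) (a q)) != 0.
Proof.
move=> U_span r_le; have [t [ts t_free t_span]] := free_subseq [seq w g | g : G].
have t_size : (r <= size t)%N.
  by move: t_free; rewrite /free t_span => /eqP <-; apply: leq_trans (dimvS U_span).
have X_size : size (take r t) == r by rewrite size_takel.
pose X := Tuple X_size.
have X_free : free X by move: t_free; rewrite -{1}(cat_take_drop r t) => /catl_free.
pose M := \matrix_(p < r, q < #|I|) (X`_p : vec) (enum_val q).
have M_free : row_free M.
  rewrite -kermx_eq0; apply/negPn/negP => /rowV0Pn[u /sub_kermxP uM] /negP; apply.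
  apply/eqP/rowP => p; rewrite mxE.
  apply: (freeP (X := X) X_free (fun p => u 0 p)); apply/ffunP => b.
  rewrite sum_ffunE ffunE; move/rowP/(_ (enum_rank b)): uM; rewrite !mxE => uM.
  rewrite -[RHS]uM; apply: eq_bigr => i _; by rewrite !mxE enum_rankK ffunE.
have [g gE] : exists g : 'I_r -> G, forall p : 'I_r, X`_p = w (g p).
  apply: (@fin_all_exists _ (fun=> G) (fun (p : 'I_r) g => X`_p = w g)) => p.
  have /mem_take/(mem_subseq ts)/mapP[g _ gE] : X`_p \in take r t.
    by apply: mem_nth; rewrite size_tuple.
  by exists g.
have M_full : row_full M^T by rewrite /row_full mxrank_tr.
pose a q := enum_val (fullrankfun M_full q); exists g, a.
have := fullrowsub_unit M_full; rewrite -unitmx_tr unitmxE unitfE.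
congr (\det _ != 0); apply/matrixP => p q.
by rewrite !mxE -gE.
Qed.

End Minors.

Section GenericPoints.

Variables (K : fieldType) (k : nat) (d : k.-tuple nat).
Local Notation fac := (factors K d).
Local Notation tspace := (tensor_space K d).
Local Notation idx := (multi_index d).

(** The [k] summands of the tangent space share the line of the tensor. *)
Lemma dim_tangent_le (v : fac) : nonzero_factors v ->
  (\dim (tangent_space v) <= 1 + \sum_i tnth d i)%N.
Proof.
move=> v0; pose f i := linfun (@tens_subst K k d v i).
pose V := (<[tens v]> + \sum_i f i @: (<[v i]>^C))%VS.
have TV : (tangent_space v <= V)%VS.
  apply/subv_sumP => i _; rewrite -(addv_complf <[v i]>) limgD subv_add limg_line.
  apply/andP; split.
    by rewrite lfunE /= tens_subst_id addvSl.
  by apply: subv_trans (addvSr _ _); apply: (sumv_sup i).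
apply: leq_trans (dimvS TV) _; apply: leq_trans (dimv_add_leqif _ _) _.
apply: leq_add; first by rewrite dim_vline leq_b1.
elim/big_rec2: _ => [|i n W _ IHW]; first by rewrite dimv0.
apply: leq_trans (dimv_add_leqif _ _) _; apply: leq_add => //.
have := limg_ker_dim (f i) (<[v i]>^C); have := dimv_compl <[v i]>.
rewrite dim_vline v0 dimvf /dim /= mul1n; lia.
Qed.

Lemma card_multi_index : #|{: idx}| = (\prod_(i < k) (tnth d i).+1)%N.
Proof.
rewrite card_dep_ffun foldrE big_map big_enum.
by apply: eq_bigr => i _; rewrite card_ord.
Qed.

Variable s : nat.
Local Notation sidx := ('I_s * idx)%type.
Local Notation ring := {mpoly K[#|{: sidx}|]}.

(** Being multihomogeneous is being homogeneous for each of these gradings. *)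
Definition block_deg (j : 'I_s) (m : 'X_{1..#|{: sidx}|}) : nat :=
  (\sum_(a : idx) m (enum_rank (j, a)))%N.

Fact block_deg0 j : block_deg j 0%MM = 0%N.
Proof. by rewrite /block_deg big1 // => a _; rewrite mnm0E. Qed.

Fact block_degD j : {morph block_deg j : m1 m2 / (m1 + m2)%MM >-> (m1 + m2)%N}.
Proof.
by move=> m1 m2; rewrite /block_deg -big_split; apply: eq_bigr => a _; rewrite mnmDE.
Qed.

HB.instance Definition _ j :=
  isMeasure.Build _ (block_deg j) (block_deg0 j) (block_degD j).

Lemma dhomog_bigprod n (R : comNzRingType) (mf : measure n) (T : finType)
    (Q : pred T) (e : T -> nat) (F : T -> {mpoly R[n]}) :
  (forall t, Q t -> F t \is (e t).-homog for mf) ->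
  \prod_(t | Q t) F t \is (\sum_(t | Q t) e t)%N.-homog for mf.
Proof.
move=> hF; elim/big_rec2: _ => [|t p m Qt IH]; first exact: dhomog1.
by apply: dhomogM => //; exact: hF.
Qed.

Lemma block_homog_multihomog (e : 'I_s -> nat) (F : ring) :
  (forall j, F \is (e j).-homog for (block_deg j)) -> multihomog F.
Proof. by move=> hF; exists e => m m_in j; exact: (dhomogP _ _ _ (hF j)). Qed.

Definition change_index (o : idx) i (x : 'I_(tnth d i).+1) : idx :=
  finfun (dfwith o x).

(** The coordinates of a tensor [p] on the multi-indices that differ from [o]
    only at [i] form, when [p = tens v], a multiple of [v i]; replacing [v i] by
    these slices of [p] makes the tangent vectors polynomial in [p]. *)
Definition tangent_coord (j : 'I_s) (o : idx) i (b : 'I_(tnth d i).+1) (a : idx) :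
    ring :=
  (b == a i)%:R *: \prod_(l | l != i) 'X_(enum_rank (j, change_index o (a l))).

Definition slice_factor (v : fac) (o : idx) i : K :=
  \prod_(l | l != i) \prod_(l' | l' != l) v l' 0 (o l').

Lemma tangent_coord_eval (v : 'I_s -> fac) j o i b a :
  eval_points (@tangent_coord j o i b a) v =
  slice_factor (v j) o i * tens_subst (v j) (delta_mx 0 b) a.
Proof.
rewrite /eval_points /eval_at mevalZ tens_substE mxE eqxx /= eq_sym.
rewrite mulrCA; congr (_ * _); rewrite rmorph_prod -big_split /=.
apply: eq_bigr => l _; rewrite mevalXU enum_rankK /= ffunE.
rewrite (bigD1 l) //= ffunE dfwith_in mulrC; congr (_ * _).
by apply: eq_bigr => l' l'l; rewrite ffunE dfwith_out // eq_sym.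
Qed.

Lemma tangent_coord_homog j j' o i b a :
  @tangent_coord j o i b a \is (if j == j' then k.-1 else 0%N).-homog
    for (block_deg j').
Proof.
apply: dhomogZ; rewrite (_ : (if _ then _ else _) =
    \sum_(l < k | l != i) (j == j'))%N; last first.
  rewrite sum_nat_const (eq_card (B := predC1 i)) // cardC1 card_ord.
  by case: eqP => _; rewrite ?muln1 ?muln0.
apply: dhomog_bigprod => l _; rewrite dhomogX /= /block_deg; apply/eqP.
under eq_bigr do rewrite mnm1E (inj_eq enum_rank_inj) xpair_eqE.
have [_|_] := eqVneq j j'; last by rewrite big1.
rewrite (bigD1 (change_index o (a l))) //= eqxx big1 // => c.
by rewrite eq_sym => /negPf ->.
Qed.

Definition expected_dim :=
  minn (s * (1 + \sum_(i < k) tnth d i)) (\prod_(i < k) (tnth d i).+1).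

Lemma dim_sum_tangent_le (v : 'I_s -> fac) :
  (forall j, nonzero_factors (v j)) ->
  (\dim (\sum_j tangent_space (v j)) <= expected_dim)%N.
Proof.
move=> v0; rewrite leq_min; apply/andP; split.
  rewrite -[X in (_ <= X * _)%N]card_ord -sum_nat_const.
  elim/big_rec2: _ => [|j n W _ IHW]; first by rewrite dimv0.
  apply: leq_trans (dimv_add_leqif _ _) _; apply: leq_add => //.
  exact: dim_tangent_le.
apply: leq_trans (dimvS (subvf _)) _; by rewrite dimvf dim_ffun card_multi_index.
Qed.

(** Semicontinuity: the rank of the tangent spaces is bounded below by the
    non-vanishing of a minor. *)
Lemma T_true_of_dim (v : 'I_s -> fac) :
  (forall j, nonzero_factors (v j)) ->
  (expected_dim <= \dim (\sum_j tangent_space (v j)))%N -> T_true K d s.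
Proof.
move=> v0 r_le; pose G := ('I_s * {i : 'I_k & 'I_(tnth d i).+1})%type.
pose tg (u : 'I_s -> fac) (g : G) : tspace :=
  tens_subst (u g.1) (delta_mx 0 (tagged g.2)).
have tg_span : (\sum_j tangent_space (v j) <= <<[seq tg v g | g : G]>>)%VS.
  apply/subv_sumP => j _; apply/subvP => w /tangent_spaceP[x ->].
  apply: memv_suml => i _; rewrite [x i]row_sum_delta linear_sum.
  apply: memv_suml => b _; rewrite linearZ; apply: memvZ; apply: memv_span.
  apply/mapP; exists (j, Tagged (fun i => 'I_(tnth d i).+1) b) => //.
  by rewrite mem_enum.
have [g [a det0]] := minor_of_dim tg_span r_le.
have [o oP] : exists o : 'I_s -> idx, forall j i, v j i 0 (o j i) != 0.
  apply: (@fin_all_exists _ (fun=> idx) (fun j (o : idx) => forall i, v j i 0 (o i) != 0)) => j.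
  have [i|o oP] := @fin_all_exists _ (fun i : 'I_k => 'I_(tnth d i).+1)
      (fun i b => v j i 0 b != 0).
    by have /rV0Pn[b] := v0 j i; exists b.
  by exists (finfun o) => i; rewrite ffunE.
pose M : 'M[ring]_expected_dim := \matrix_(p, q)
  tangent_coord (g p).1 (o (g p).1) (tagged (g p).2) (a q).
have evM (u : 'I_s -> fac) : eval_points (\det M) u =
    \prod_p slice_factor (u (g p).1) (o (g p).1) (tag (g p).2) *
    \det (\matrix_(p, q) tg u (g p) (a q)).
  rewrite /eval_points /eval_at -det_map_mx /=.
  rewrite [map_mx _ _](_ : _ =
    diag_mx (\row_p slice_factor (u (g p).1) (o (g p).1) (tag (g p).2)) *m
    (\matrix_(p, q) tg u (g p) (a q))).
    rewrite det_mulmx det_diag; congr (_ * _).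
    by apply: eq_bigr => p _; rewrite mxE.
  apply/matrixP => p q; rewrite mul_diag_mx !mxE; exact: tangent_coord_eval.
exists (\det M); split.
- apply: (@block_homog_multihomog (fun j => \sum_p if (g p).1 == j then k.-1 else 0%N)%N).
  move=> j; apply: rpred_sum => sg _; rewrite mulr_sign.
  have P : \prod_p M p ((sg : {perm 'I_expected_dim}) p) \is
      (\sum_p if (g p).1 == j then k.-1 else 0%N)%N.-homog for (block_deg j).
    by apply: dhomog_bigprod => p _; rewrite mxE; exact: tangent_coord_homog.
  by case: ifP => _ //; rewrite rpredN.
- exists v; split=> //; rewrite evM mulf_neq0 //.
  apply/prodf_neq0 => p _; apply/prodf_neq0 => l _; apply/prodf_neq0 => l' _.
  exact: oP.
- move=> u u0; rewrite evM mulf_eq0 negb_or => /andP[_ detu].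
  apply/eqP; rewrite eqn_leq dim_sum_tangent_le //=.
  apply: leq_dim_minor detu => p.
  by apply: (subvP (sumv_sup (g p).1 isT (subvv _))); exact: mem_tangent.
Qed.

End GenericPoints.

(** * Conditions on cubic polynomials *)

Section ScalarSystem.

Variable K : fieldType.

Lemma mul_eq0r (c x : K) : c != 0 -> c * x = 0 -> x = 0.
Proof. by move=> c0 /eqP; rewrite mulf_eq0 (negPf c0) => /eqP. Qed.

Lemma eq0_of_sub (x y z : K) : y = 0 -> z = 0 -> x = y - z -> x = 0.
Proof. by move=> -> -> ->; rewrite subr0. Qed.

Definition cubic (a b c e x : K) := a + x * b + x ^+ 2 * c + x ^+ 3 * e.

Lemma cubic_eq0 (a b c e : K) (xs : seq K) :
  uniq xs -> size xs = 4 -> (forall x, x \in xs -> cubic a b c e x = 0) ->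
  [/\ a = 0, b = 0, c = 0 & e = 0].
Proof.
move=> xs_uniq xs_size xs_root; pose p := Poly [:: a; b; c; e].
have p_root x : x \in xs -> root p x.
  move=> /xs_root x0; rewrite /root horner_Poly /=; apply/eqP.
  by rewrite -[RHS]x0 /cubic; ring.
have p0 : p = 0.
  apply/eqP/negPn/negP => pN0; have xs_all : all (root p) xs by apply/allP.
  have := leq_trans (max_poly_roots pN0 xs_all xs_uniq) (size_Poly _).
  by rewrite xs_size ltnn.
have pi i : [:: a; b; c; e]`_i = 0 by rewrite -coef_Poly -/p p0 coef0.
by split; [exact: (pi 0) | exact: (pi 1) | exact: (pi 2) | exact: (pi 3)].
Qed.

(** Two cubics [g], [h] sharing two roots, with [g] vanishing at 0, [h] at
    infinity and [g + h] at 1, are proportional to [x (x - s) (x - t)] and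
    [- (x - s) (x - t)], with the same factor. *)
Lemma cubic_pair (s t g00 g10 g01 g11 h00 h10 h01 h11 : K) :
  s != 0 -> t != 0 -> s != 1 -> t != 1 -> s != t -> g00 = 0 -> h11 = 0 ->
  cubic g00 g10 g01 g11 s = 0 -> cubic g00 g10 g01 g11 t = 0 ->
  cubic h00 h10 h01 h11 s = 0 -> cubic h00 h10 h01 h11 t = 0 ->
  cubic g00 g10 g01 g11 1 + cubic h00 h10 h01 h11 1 = 0 ->
  [/\ g10 = s * t * g11, g01 = - (s + t) * g11, h00 = - (s * t) * g11,
      h10 = (s + t) * g11 & h01 = - g11].
Proof.
rewrite /cubic => s0 t0 s1 t1 st -> -> gs gt hs ht gh.
have st0 : s - t != 0 by rewrite subr_eq0.
have {gs} gs : g10 + s * g01 + s ^+ 2 * g11 = 0.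
  by apply: (mul_eq0r s0); rewrite -[RHS]gs; ring.
have {gt} gt : g10 + t * g01 + t ^+ 2 * g11 = 0.
  by apply: (mul_eq0r t0); rewrite -[RHS]gt; ring.
have e1 : g01 + (s + t) * g11 = 0.
  apply: (mul_eq0r st0); apply: (eq0_of_sub gs gt); ring.
have g01E : g01 = - (s + t) * g11 by rewrite mulNr; apply/eqP; rewrite -addr_eq0 e1.
have g10E : g10 = s * t * g11.
  by apply/eqP; rewrite -subr_eq0 -gs g01E; apply/eqP; ring.
have e2 : h10 + (s + t) * h01 = 0.
  apply: (mul_eq0r st0); apply: (eq0_of_sub hs ht); ring.
have h10E : h10 = - (s + t) * h01 by rewrite mulNr; apply/eqP; rewrite -addr_eq0 e2.
have h00E : h00 = s * t * h01.
  by apply/eqP; rewrite -subr_eq0 -hs h10E; apply/eqP; ring.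
have h01E : h01 = - g11.
  apply/eqP; rewrite -addr_eq0 addrC; apply/eqP.
  have c0 : (1 - s) * (1 - t) != 0 by rewrite mulf_neq0 // subr_eq0 eq_sym.
  by apply: (mul_eq0r c0); rewrite -[RHS]gh g01E g10E h10E h00E; ring.
by rewrite h10E h00E h01E; split=> //; ring.
Qed.

(** For an index beyond the first two, [nu00], [nu10], [nu01] and [nu] are the
    coefficients of the diagonal cubic, which vanishes at [s] together with its
    partial derivatives as a bilinear form, while [eta] and [gam] are the factors
    that [cubic_pair] leaves for the column and for the row of this index.  The
    last three equations are the derivatives at [t]. *)
Lemma diagonal_block (s t nu00 nu10 nu01 nu eta gam : K) :
  t != 0 -> s != t -> s + t != 0 ->
  nu00 + s * nu10 = 0 -> nu10 + s ^+ 2 * nu = 0 -> nu01 + s * nu = 0 ->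
  nu00 - s * t * eta + t ^+ 2 * (nu01 - eta - (s + t) * gam) = 0 ->
  nu10 + (s + t) * eta + s * t * gam + t ^+ 2 * (nu + gam) = 0 ->
  nu00 - s * t * eta + t * (nu10 + (s + t) * eta + s * t * gam) = 0 ->
  [/\ nu00 = 0, nu10 = 0, nu01 = 0, nu = 0 & eta = 0 /\ gam = 0].
Proof.
move=> t0 st sDt e00 e10 e01 E1 E2 E3.
have nu10E : nu10 = - s ^+ 2 * nu by rewrite mulNr; apply/eqP; rewrite -addr_eq0 e10.
have nu01E : nu01 = - s * nu by rewrite mulNr; apply/eqP; rewrite -addr_eq0 e01.
have nu00E : nu00 = s ^+ 3 * nu.
  by apply/eqP; rewrite -subr_eq0 -e00 nu10E; apply/eqP; ring.
have st0 : s - t != 0 by rewrite subr_eq0.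
have {}E1 : s * nu * (s - t) - t * eta - t ^+ 2 * gam = 0.
  by apply: (mul_eq0r sDt); rewrite -[RHS]E1 nu00E nu01E; ring.
have {}E2 : nu * (t - s) + eta + t * gam = 0.
  by apply: (mul_eq0r sDt); rewrite -[RHS]E2 nu10E; ring.
have nu0 : nu = 0.
  apply: (mul_eq0r st0); apply: (mul_eq0r st0).
  have tE2 := congr1 ( *%R (- t)) E2; rewrite mulr0 in tE2.
  by apply: (eq0_of_sub E1 tE2); ring.
have {}E3 : eta + s * gam = 0.
  apply: (mul_eq0r t0); apply: (mul_eq0r t0).
  by rewrite -[RHS]E3 nu00E nu10E nu0; ring.
have gam0 : gam = 0.
  apply: (mul_eq0r st0); apply: (eq0_of_sub E3 E2); rewrite nu0; ring.
have eta0 : eta = 0 by move: E3; rewrite gam0 mulr0 addr0.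
by rewrite nu00E nu10E nu01E nu0 eta0 gam0 !mulr0.
Qed.

End ScalarSystem.

(** * Tensors with four factors *)

Definition pairing (K : fieldType) (I : finType) (L : I -> K)
  (w : {ffun I -> K^o}) : K := \sum_a L a * w a.

Lemma pairingD (K : fieldType) (I : finType) (L : I -> K) w w' :
  pairing L (w + w') = pairing L w + pairing L w'.
Proof.
by rewrite -big_split; apply: eq_bigr => a _; rewrite ffunE mulrDr.
Qed.

Lemma pairingZ (K : fieldType) (I : finType) (L : I -> K) c w :
  pairing L (c *: w) = c * pairing L w.
Proof.
by rewrite mulr_sumr; apply: eq_bigr => a _; rewrite ffunE /= mulrCA.
Qed.

Lemma pairing_delta (K : fieldType) (I : finType) (L : I -> K) a :
  pairing L (delta K a) = L a.
Proof.
rewrite /pairing (bigD1 a) //= ffunE eqxx mulr1 big1 ?addr0 // => b ba.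
by rewrite ffunE eq_sym (negPf ba) mulr0.
Qed.

(** By duality: the annihilator of [U] injects into the space of functions on
    [S]. *)
Lemma dim_ge_of_annihilator (K : fieldType) (I : finType)
    (U : {vspace {ffun I -> K^o}}) (S : seq I) :
  (forall L : I -> K, (forall w, w \in U -> pairing L w = 0) ->
     (forall a, a \in S -> L a = 0) -> forall a, L a = 0) ->
  (#|I| <= \dim U + size S)%N.
Proof.
move=> annU; pose V := (U + <<[seq delta K a | a <- S]>>)%VS.
have -> : #|I| = \dim V.
  rewrite -(dim_ffun K I) -dimvf; apply/eqP.
  rewrite eqn_leq (dimvS (subvf V)) andbT; apply: dimvS.
  apply/subvP => w _; apply/negPn/negP => wV.
  have : w - projv V w != 0.
    by apply: contra wV; rewrite subr_eq0 => /eqP ->; apply: memv_proj.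
  move=> /eqP; apply; apply/ffunP => b; rewrite [RHS]ffunE.
  pose L a : K := (delta K a - projv V (delta K a)) b.
  have LE w' : pairing L w' = (w' - projv V w') b.
    rewrite [in RHS](ffun_delta w') linear_sum -sumrB sum_ffunE.
    by apply: eq_bigr => a _; rewrite linearZ /= -scalerBr ffunE mulrC.
  have LV w' : w' \in V -> pairing L w' = 0.
    by move=> w'V; rewrite LE projv_id // subrr ffunE.
  rewrite -LE /pairing big1 // => a _; rewrite annU ?mul0r //.
    by move=> w' w'U; apply: LV; apply: (subvP (addvSl _ _)).
  move=> a' a'S; rewrite -pairing_delta; apply: LV.
  by apply: (subvP (addvSr _ _)); apply/memv_span/map_f.
apply: leq_trans (dimv_add_leqif _ _) _; rewrite leq_add2l.
by apply: leq_trans (dim_span _) _; rewrite size_map.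
Qed.

Section FourFactors.

Variables (K : fieldType) (n : nat).

(** [n] is one less than the projective dimension of the last two factors: they
    have at least two coordinates, of indices [ord0] and [o1]. *)
Definition d4 := [tuple 1; 1; n.+1; n.+1]%N.

(** The matching is on the number underlying [i], so that [tnth d4 i] reduces in
    each branch. *)
Definition by4 (T : nat -> Type) (x0 x1 : T 1%N) (x2 x3 : T n.+1) (i : 'I_4) :
    T (tnth d4 i) :=
  let: Ordinal m lt_m := i in
  match m return forall lt_m : (m < 4)%N, T (tnth d4 (Ordinal lt_m)) with
  | 0 => fun=> x0
  | 1 => fun=> x1
  | 2 => fun=> x2
  | 3 => fun=> x3
  | m'.+4 => fun lt_m => False_rect _ (notF lt_m)
  end lt_m.

Definition pos0 : 'I_4 := @Ordinal 4 0 isT.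
Definition pos1 : 'I_4 := @Ordinal 4 1 isT.
Definition pos2 : 'I_4 := @Ordinal 4 2 isT.
Definition pos3 : 'I_4 := @Ordinal 4 3 isT.

Lemma pos_ind (P : 'I_4 -> Prop) :
  P pos0 -> P pos1 -> P pos2 -> P pos3 -> forall i, P i.
Proof.
move=> P0 P1 P2 P3 [[|[|[|[|m]]]] lt_m] //.
- by rewrite (_ : Ordinal lt_m = pos0) //; apply: val_inj.
- by rewrite (_ : Ordinal lt_m = pos1) //; apply: val_inj.
- by rewrite (_ : Ordinal lt_m = pos2) //; apply: val_inj.
- by rewrite (_ : Ordinal lt_m = pos3) //; apply: val_inj.
Qed.

Lemma big_pos (R : Type) (idx : R) (op : Monoid.law idx) (F : 'I_4 -> R) :
  \big[op/idx]_i F i = op (F pos0) (op (F pos1) (op (F pos2) (F pos3))).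
Proof.
rewrite !big_ord_recl big_ord0 Monoid.mulm1.
congr (op (F _) (op (F _) (op (F _) (F _)))); exact: val_inj.
Qed.

Definition fac4 (a b : 'rV[K]_2) (c d : 'rV[K]_n.+2) : factors K d4 :=
  @by4 (fun p => 'rV[K]_p.+1) a b c d.

Definition ix4 (i j : 'I_2) (r t : 'I_n.+2) : multi_index d4 :=
  finfun (@by4 (fun p => 'I_p.+1) i j r t).

Definition tens4 a b c d : tensor_space K d4 := tens (fac4 a b c d).

Lemma tens4E a b c d i j r t :
  tens4 a b c d (ix4 i j r t) = a 0 i * (b 0 j * (c 0 r * d 0 t)).
Proof. by rewrite ffunE big_pos /ix4 !ffunE. Qed.

Lemma ix4_onto (x : multi_index d4) :
  ix4 (x pos0) (x pos1) (x pos2) (x pos3) = x.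
Proof. by apply/ffunP; apply: pos_ind; rewrite ffunE. Qed.

Lemma tens4_ext (w w' : tensor_space K d4) :
  (forall i j r t, w (ix4 i j r t) = w' (ix4 i j r t)) -> w = w'.
Proof. by move=> ww; apply/ffunP => x; rewrite -(ix4_onto x). Qed.

Lemma tens_subst4 a b c d :
  [/\ forall x, tens_subst (fac4 a b c d) (i := pos0) x = tens4 x b c d,
      forall x, tens_subst (fac4 a b c d) (i := pos1) x = tens4 a x c d,
      forall x, tens_subst (fac4 a b c d) (i := pos2) x = tens4 a b x d &
      forall x, tens_subst (fac4 a b c d) (i := pos3) x = tens4 a b c x].
Proof.
by split=> x; apply: tens4_ext => i j r t;
  rewrite tens4E ffunE big_pos ?dfwith_in ?dfwith_out // /ix4 !ffunE.
Qed.

End FourFactors.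

(** * Points with tangent spaces of large span *)

Section SpecialPoints.

Variables (K : fieldType) (n : nat).
Hypothesis charK0 : [pchar K] =i pred0.
Local Notation tspace := (tensor_space K (d4 n)).

Definition e2 (i : 'I_2) : 'rV[K]_2 := delta_mx 0 i.
Definition eN (r : 'I_n.+2) : 'rV[K]_n.+2 := delta_mx 0 r.
Definition curve (x : K) : 'rV[K]_2 := e2 ord0 + x *: e2 ord_max.
Definition o1 : 'I_n.+2 := inord 1.

Lemma tens4_lin a a' b b' c c' d d' (x : K) :
  [/\ tens4 (a + x *: a') b c d = tens4 a b c d + x *: tens4 a' b c d,
      tens4 a (b + x *: b') c d = tens4 a b c d + x *: tens4 a b' c d,
      tens4 a b (c + c') d = tens4 a b c d + tens4 a b c' d :> tspace &
      tens4 a b c (d + d') = tens4 a b c d + tens4 a b c d' :> tspace].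
Proof.
by split; apply: tens4_ext => i j r t; rewrite !(tens4E, ffunE) !mxE;
  rewrite /GRing.scale /=; ring.
Qed.

Lemma ix4_eq i j r t i' j' r' t' :
  (ix4 i j r t == ix4 i' j' r' t' :> multi_index (d4 n)) =
  [&& i == i', j == j', r == r' & t == t'].
Proof.
apply/eqP/and4P => [/ffunP e|[/eqP-> /eqP-> /eqP-> /eqP->] //].
by split; apply/eqP; [have := e pos0 | have := e pos1 | have := e pos2 | have := e pos3];
  rewrite !ffunE.
Qed.

Lemma tens4_delta i j r t :
  tens4 (e2 i) (e2 j) (eN r) (eN t) = delta K (ix4 i j r t).
Proof.
apply: tens4_ext => i' j' r' t'; rewrite tens4E ffunE ix4_eq !mxE !eqxx /=.
rewrite ![_ == i']eq_sym ![_ == j']eq_sym ![_ == r']eq_sym ![_ == t']eq_sym.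
by case: (_ == i); case: (_ == j); case: (_ == r); case: (_ == t);
  rewrite ?mulr1 ?mulr0 ?mul0r.
Qed.

(** Any distinct values, different from 0, 1 and their mutual opposites, would do
    for the nodes of the indices [l > 1]. *)
Definition node_s (l : nat) : K := (2 * l)%:R.
Definition node_t (l : nat) : K := (2 * l + 1)%:R.

(** Over the curve [(curve x, curve (x ^ 2))] a bilinear form on the first two
    factors is an arbitrary cubic polynomial in [x].  The points at 0, infinity
    and 1 deal with the first two coordinates of the last two factors; then
    [point_s] and [point_t] deal with the coordinate [l], the latter linking it to
    the first two.  The last point separates the forms that are left. *)
Definition point_0 := fac4 (e2 ord0) (e2 ord0) (eN ord0) (eN ord0).
Definition point_oo := fac4 (e2 ord_max) (e2 ord_max) (eN o1) (eN o1).
Definition point_1 :=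
  fac4 (curve 1) (curve 1) (eN ord0 + eN o1) (eN ord0 + eN o1).
Definition point_s (l : 'I_n.+2) :=
  fac4 (curve (node_s l)) (curve (node_s l ^+ 2)) (eN l) (eN l).
Definition point_t (l : 'I_n.+2) :=
  fac4 (curve (node_t l)) (curve (node_t l ^+ 2)) (eN l + eN ord0) (eN l + eN o1).
Definition point_q :=
  fac4 (e2 ord0) (curve 1) (eN o1) (eN o1).

Definition kills (L : multi_index (d4 n) -> K) (v : factors K (d4 n)) :=
  forall w, w \in tangent_space v -> pairing L w = 0.

Lemma ord2_ind (P : 'I_2 -> Prop) : P ord0 -> P ord_max -> forall i, P i.
Proof.
move=> P0 P1 [[|[|m]] lt_m] //.
  by rewrite (_ : Ordinal lt_m = ord0) //; apply: val_inj.
by rewrite (_ : Ordinal lt_m = ord_max) //; apply: val_inj.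
Qed.

Lemma small_index (r : 'I_n.+2) : (r < 2)%N -> r = ord0 \/ r = o1.
Proof.
case: r => [[|[|m]] lt_m] // _; [left|right]; apply: val_inj => //=.
by rewrite inordK.
Qed.

Lemma natr_eqE (a b : nat) : (a%:R == b%:R :> K) = (a == b).
Proof. exact/inj_eq/pchar0_natr_inj. Qed.

Section Annihilator.

Variable L : multi_index (d4 n) -> K.
Local Notation form a b c d := (pairing L (tens4 a b c d)).
Local Notation g i j r t := (L (ix4 i j r t)).

Lemma kills_fac4 a b c d : kills L (fac4 a b c d) ->
  [/\ forall x, form x b c d = 0, forall x, form a x c d = 0,
      forall x, form a b x d = 0 & forall x, form a b c x = 0].
Proof.
move=> kv; have [h0 h1 h2 h3] := tens_subst4 a b c d.
by split=> x; [rewrite -h0 | rewrite -h1 | rewrite -h2 | rewrite -h3];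
  apply: kv; exact: mem_tangent.
Qed.

Lemma formL x b c d :
  form (curve x) b c d = form (e2 ord0) b c d + x * form (e2 ord_max) b c d.
Proof.
by have [-> _ _ _] := tens4_lin (e2 ord0) (e2 ord_max) b b c c d d x;
  rewrite pairingD pairingZ.
Qed.

Lemma formR x a c d :
  form a (curve x) c d = form a (e2 ord0) c d + x * form a (e2 ord_max) c d.
Proof.
by have [_ -> _ _] := tens4_lin a a (e2 ord0) (e2 ord_max) c c d d x;
  rewrite pairingD pairingZ.
Qed.

Lemma form3 a b c c' d : form a b (c + c') d = form a b c d + form a b c' d.
Proof. by have [_ _ -> _] := tens4_lin a a b b c c' d d 0; rewrite pairingD. Qed.

Lemma form4 a b c d d' : form a b c (d + d') = form a b c d + form a b c d'.
Proof. by have [_ _ _ ->] := tens4_lin a a b b c c d d' 0; rewrite pairingD. Qed.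

Lemma form_delta i j r t : form (e2 i) (e2 j) (eN r) (eN t) = g i j r t.
Proof. by rewrite tens4_delta pairing_delta. Qed.

Definition cubic_at x r t :=
  cubic (g ord0 ord0 r t) (g ord_max ord0 r t) (g ord0 ord_max r t)
    (g ord_max ord_max r t) x.

Lemma form_curve x r t :
  form (curve x) (curve (x ^+ 2)) (eN r) (eN t) = cubic_at x r t.
Proof.
by rewrite formL !formR !form_delta /cubic_at /cubic; ring.
Qed.

Hypotheses (k0 : kills L point_0) (koo : kills L point_oo) (k1 : kills L point_1).
Hypothesis ks : forall l : 'I_n.+2, (1 < l)%N -> kills L (point_s l).
Hypothesis kt : forall l : 'I_n.+2, (1 < l)%N -> kills L (point_t l).
Hypotheses (gu : g ord0 ord0 o1 o1 = 0) (gv : g ord0 ord_max ord0 o1 = 0).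

(** Let the weight of a basis tensor be the number of its indices equal to 1.
    The tangent spaces at 0 and infinity contain the basis tensors of weight
    different from 2, and the one at 1 gives four conditions on the six remaining
    coordinates; [gu] and [gv] dispose of the last two dimensions. *)
Lemma corner_eq0 i j (r t : 'I_n.+2) : (r < 2)%N -> (t < 2)%N -> g i j r t = 0.
Proof.
have [A0 A1 A2 A3] := kills_fac4 k0; have [B0 B1 B2 B3] := kills_fac4 koo.
have [C0 C1 C2 C3] := kills_fac4 k1.
have {}A0 x := A0 (e2 x); have {}A1 x := A1 (e2 x).
have {}A2 x := A2 (eN x); have {}A3 x := A3 (eN x).
have {}B0 x := B0 (e2 x); have {}B1 x := B1 (e2 x).
have {}B2 x := B2 (eN x); have {}B3 x := B3 (eN x).
have {}A0 x : g x ord0 ord0 ord0 = 0 by rewrite -form_delta.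
have {}A1 x : g ord0 x ord0 ord0 = 0 by rewrite -form_delta.
have {}A2 x : g ord0 ord0 x ord0 = 0 by rewrite -form_delta.
have {}A3 x : g ord0 ord0 ord0 x = 0 by rewrite -form_delta.
have {}B0 x : g x ord_max o1 o1 = 0 by rewrite -form_delta.
have {}B1 x : g ord_max x o1 o1 = 0 by rewrite -form_delta.
have {}B2 x : g ord_max ord_max x o1 = 0 by rewrite -form_delta.
have {}B3 x : g ord_max ord_max o1 x = 0 by rewrite -form_delta.
have := C0 (e2 ord_max); have := C0 (e2 ord0); have := C1 (e2 ord_max).
have := C2 (eN o1); have := C3 (eN o1).
rewrite !(formL, formR, form3, form4, form_delta) gu gv !mul1r.
rewrite !(A0, A1, A2, A3, B0, B1, B2, B3) !(add0r, addr0) => h1 + + h2.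
rewrite h1 h2 !add0r => h3 h4 _.
by case/small_index=> ->; case/small_index=> ->;
  elim/ord2_ind: i; elim/ord2_ind: j.
Qed.

(** Outside of the corner, a pair of rows (or of columns) has a single degree of
    freedom, and the two remaining scalars are killed by the diagonal block. *)
Lemma border_eq0 i j (l : 'I_n.+2) : (1 < l)%N ->
  [/\ g i j l l = 0, g i j ord0 l = 0, g i j o1 l = 0,
      g i j l ord0 = 0 & g i j l o1 = 0].
Proof.
move=> l_gt1; have [_ _ A2 A3] := kills_fac4 k0.
have [_ _ B2 B3] := kills_fac4 koo; have [_ _ C2 C3] := kills_fac4 k1.
have [S0 S1 S2 S3] := kills_fac4 (ks l_gt1).
have [T0 T1 T2 T3] := kills_fac4 (kt l_gt1).
have l0 : (node_s l != 0) /\ (node_t l != 0).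
  by rewrite -[0](mulr0n 1) !natr_eqE; lia.
have l1 : (node_s l != 1) /\ (node_t l != 1).
  by rewrite -[1](mulr1n 1) !natr_eqE; lia.
have st : node_s l != node_t l by rewrite natr_eqE; lia.
have sDt : node_s l + node_t l != 0.
  by rewrite -natrD -[0](mulr0n 1) natr_eqE; lia.
have o1lt : (o1 < 2)%N by rewrite inordK.
have corner x (r t : 'I_n.+2) : (r < 2)%N -> (t < 2)%N -> cubic_at x r t = 0.
  by move=> r2 t2; rewrite /cubic_at !corner_eq0 // /cubic; ring.
have {}S2 r : cubic_at (node_s l) r l = 0 by rewrite -form_curve.
have {}S3 r : cubic_at (node_s l) l r = 0 by rewrite -form_curve.
have {}T2 (r : 'I_n.+2) : (r < 2)%N -> cubic_at (node_t l) r l = 0.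
  move=> r2; have := T2 (eN r); rewrite form4 !form_curve.
  by rewrite [X in _ + X]corner // addr0.
have {}T3 (r : 'I_n.+2) : (r < 2)%N -> cubic_at (node_t l) l r = 0.
  move=> r2; have := T3 (eN r); rewrite form3 !form_curve.
  by rewrite [X in _ + X]corner // addr0.
have {}C2 : cubic_at 1 l ord0 + cubic_at 1 l o1 = 0.
  by have := C2 (eN l); rewrite form4 -{2 4}(expr1n K 2) !form_curve.
have {}C3 : cubic_at 1 ord0 l + cubic_at 1 o1 l = 0.
  by have := C3 (eN l); rewrite form3 -{2 4}(expr1n K 2) !form_curve.
have {}A2 : g ord0 ord0 l ord0 = 0 by rewrite -form_delta.
have {}A3 : g ord0 ord0 ord0 l = 0 by rewrite -form_delta.
have {}B2 : g ord_max ord_max l o1 = 0 by rewrite -form_delta.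
have {}B3 : g ord_max ord_max o1 l = 0 by rewrite -form_delta.
have [s0 t0] := l0; have [s1 t1] := l1.
have [r10 r01 r00' r10' r01'] := cubic_pair s0 t0 s1 t1 st A3 B3 (S2 ord0)
  (T2 ord0 isT) (S2 o1) (T2 o1 o1lt) C3.
have [c10 c01 c00' c10' c01'] := cubic_pair s0 t0 s1 t1 st A2 B2 (S3 ord0)
  (T3 ord0 isT) (S3 o1) (T3 o1 o1lt) C2.
have E1 := T0 (e2 ord0); have E2 := T0 (e2 ord_max); have E3 := T1 (e2 ord0).
have D1 := S1 (e2 ord0); have D2 := S0 (e2 ord_max); have D3 := S1 (e2 ord_max).
rewrite !(formL, formR, form3, form4, form_delta) in E1 E2 E3 D1 D2 D3.
have corner_g i' j' : g i' j' ord0 o1 = 0 by exact: corner_eq0.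
have [||| n00 n10 n01 n11 [eta0 gam0]] := @diagonal_block K (node_s l) (node_t l)
  _ _ _ _ (g ord_max ord_max l ord0) (g ord_max ord_max ord0 l) t0 st sDt D1 D2 D3.
- by rewrite -[RHS]E1 !corner_g c00' c01' A3 r01; ring.
- by rewrite -[RHS]E2 !corner_g c10' r10 B2; ring.
- by rewrite -[RHS]E3 !corner_g c00' A3 c10' r10; ring.
rewrite eta0 in c10 c01 c00' c10' c01'; rewrite gam0 in r10 r01 r00' r10' r01'.
rewrite !mulr0 ?oppr0 in c10 c01 c00' c10' c01' r10 r01 r00' r10' r01'.
by elim/ord2_ind: i; elim/ord2_ind: j.
Qed.

(** The cubic polynomial of a pair of distinct indices beyond the first two
    vanishes at the four nodes of these indices. *)
Lemma kills_eq0 x : L x = 0.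
Proof.
rewrite -(ix4_onto x); move: (x pos0) (x pos1) (x pos2) (x pos3) => i j r t.
have [r2|r2] := ltnP r 2; have [t2|t2] := ltnP t 2.
- exact: corner_eq0.
- have [_ h0 h1 _ _] := border_eq0 i j t2.
  by case: (small_index r2) => ->.
- have [_ _ _ h0 h1] := border_eq0 i j r2.
  by case: (small_index t2) => ->.
have [->|rt] := eqVneq r t; first by have [] := border_eq0 i j t2.
have [_ _ S2 S3] := kills_fac4 (ks t2).
have [_ _ S2' S3'] := kills_fac4 (ks r2).
have [_ _ T2 T3] := kills_fac4 (kt t2).
have [_ _ T2' T3'] := kills_fac4 (kt r2).
have z1 y : cubic_at y ord0 t = 0.
  have h i' j' : g i' j' ord0 t = 0 by case: (border_eq0 i' j' t2).
  by rewrite /cubic_at !h /cubic; ring.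
have z2 y : cubic_at y r o1 = 0.
  have h i' j' : g i' j' r o1 = 0 by case: (border_eq0 i' j' r2).
  by rewrite /cubic_at !h /cubic; ring.
have [] := @cubic_eq0 K (g ord0 ord0 r t) (g ord_max ord0 r t)
  (g ord0 ord_max r t) (g ord_max ord_max r t)
  [:: node_s r; node_s t; node_t r; node_t t] _ erefl _.
- have {}rt : nat_of_ord r != nat_of_ord t by [].
  rewrite /node_s /node_t /= !inE !negb_or !natr_eqE.
  move: (nat_of_ord r) (nat_of_ord t) rt => a b ab; lia.
- move=> y; rewrite !inE -/(cubic_at y r t) => /or4P[] /eqP ->.
  + by rewrite -form_curve.
  + by rewrite -form_curve.
  + by have := T3' (eN t); rewrite form3 !form_curve z1 addr0.
  + by have := T2 (eN r); rewrite form4 !form_curve z2 addr0.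
move=> h00 h10 h01 h11.
by elim/ord2_ind: i; elim/ord2_ind: j.
Qed.

End Annihilator.
End SpecialPoints.

(** * Dimensions of the sums of tangent spaces *)

Section TangentSums.

Variables (K : fieldType) (n : nat).
Hypothesis charK0 : [pchar K] =i pred0.
Local Notation tspace := (tensor_space K (d4 n)).
Local Notation e2 := (e2 K).
Local Notation eN := (@eN K n).

(** The order matters: the first [2 * n.+1] points have independent tangent
    spaces, those at 0, 1 and infinity do not, and [point_q] is only used to fill
    the space. *)
Definition points (j : nat) : factors K (d4 n) :=
  if j == 0%N then point_0 K n else if j == 1%N then point_oo K n else
  if (j < 2 * n.+1)%N then
    if odd j then point_t K (inord j./2.+1) else point_s K (inord j./2.+1)
  else if j == (2 * n.+1)%N then point_1 K n else point_q K n.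

Definition tangent_sum s : {vspace tspace} := (\sum_(j < s) tangent_space (points j))%VS.

Lemma points_s (l : 'I_n.+2) : (1 < l)%N -> points (2 * l.-1) = point_s K l.
Proof.
move=> l1; have lN := ltn_ord l; rewrite /points.
have -> : (2 * l.-1 == 0)%N = false by lia.
have -> : (2 * l.-1 == 1)%N = false by lia.
have -> : (2 * l.-1 < 2 * n.+1)%N by lia.
rewrite mul2n odd_double doubleK prednK; last by lia.
by rewrite inord_val.
Qed.

Lemma points_t (l : 'I_n.+2) : (1 < l)%N -> points (2 * l.-1).+1 = point_t K l.
Proof.
move=> l1; have lN := ltn_ord l; rewrite /points.
have -> : ((2 * l.-1).+1 == 0)%N = false by [].
have -> : ((2 * l.-1).+1 == 1)%N = false by lia.
have -> : ((2 * l.-1).+1 < 2 * n.+1)%N by lia.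
rewrite mul2n /= odd_double /= uphalf_double prednK; last by lia.
by rewrite inord_val.
Qed.

Lemma points_1 : points (2 * n.+1) = point_1 K n.
Proof. by rewrite /points ltnn eqxx; do 2?[case: eqP => [?|_]; first by lia]. Qed.

Lemma points_q : points (2 * n.+1).+1 = point_q K n.
Proof.
rewrite /points ltnNge leqnSn /=.
by do 2?[case: eqP => [?|_]; first by lia].
Qed.

Lemma o1_neq0 : o1 n != ord0.
Proof. by rewrite -val_eqE /= inordK. Qed.

Lemma row_neq0 p (v : 'rV[K]_p) i : v 0 i != 0 -> v != 0.
Proof. by move=> vi; apply/rV0Pn; exists i. Qed.

Lemma curve_neq0 x : curve x != 0 :> 'rV[K]_2.
Proof. by apply: (@row_neq0 _ _ ord0); rewrite !mxE eqxx mulr0 addr0 oner_eq0. Qed.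

Lemma e2_neq0 i : e2 i != 0.
Proof. by apply: (@row_neq0 _ _ i); rewrite !mxE !eqxx oner_eq0. Qed.

Lemma eN_neq0 r : eN r != 0.
Proof. by apply: (@row_neq0 _ _ r); rewrite !mxE !eqxx oner_eq0. Qed.

Lemma eND_neq0 r t : r != t -> eN r + eN t != 0.
Proof.
move=> rt; apply: (@row_neq0 _ _ r).
by rewrite !mxE !eqxx (negPf rt) addr0 oner_eq0.
Qed.

Lemma points_neq0 j : nonzero_factors (points j).
Proof.
rewrite /points; have [_|_] := eqVneq j 0%N.
  by apply: pos_ind; [exact: e2_neq0|exact: e2_neq0|exact: eN_neq0|exact: eN_neq0].
have [_|j1] := eqVneq j 1%N.
  by apply: pos_ind; [exact: e2_neq0|exact: e2_neq0|exact: eN_neq0|exact: eN_neq0].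
case: ifP => [j_lt|_].
  have lt_l : (j./2.+1 < n.+2)%N by lia.
  case: ifP => oj; apply: pos_ind.
  - exact: curve_neq0.
  - exact: curve_neq0.
  - by apply: eND_neq0; rewrite -val_eqE /= inordK.
  - by apply: eND_neq0; rewrite -val_eqE /= !inordK //; lia.
  - exact: curve_neq0.
  - exact: curve_neq0.
  - exact: eN_neq0.
  - exact: eN_neq0.
case: ifP => _; apply: pos_ind.
- exact: curve_neq0.
- exact: curve_neq0.
- by apply: eND_neq0; rewrite eq_sym o1_neq0.
- by apply: eND_neq0; rewrite eq_sym o1_neq0.
- exact: e2_neq0.
- exact: curve_neq0.
- exact: eN_neq0.
- exact: eN_neq0.
Qed.

Lemma tangent_sum_kills (L : multi_index (d4 n) -> K) s j :
  (forall w, w \in tangent_sum s -> pairing L w = 0) -> (j < s)%N ->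
  kills L (points j).
Proof.
move=> Ls j_lt w wT; apply: Ls.
by apply: (subvP (sumv_sup (Ordinal j_lt) isT (subvv _))).
Qed.

Lemma tangent_sum_eq0 (L : multi_index (d4 n) -> K) s :
  (2 * n.+1 < s)%N -> (forall w, w \in tangent_sum s -> pairing L w = 0) ->
  L (ix4 ord0 ord0 (o1 n) (o1 n)) = 0 -> L (ix4 ord0 ord_max ord0 (o1 n)) = 0 ->
  forall x, L x = 0.
Proof.
move=> s_gt Ls gu gv; have kj j := tangent_sum_kills Ls (j := j).
apply: (kills_eq0 charK0 _ _ _ _ _ gu gv).
- by apply: (kj 0%N); lia.
- by apply: (kj 1%N); lia.
- by rewrite -points_1; apply: kj.
- by move=> l l1; rewrite -points_s //; apply: kj; have := ltn_ord l; lia.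
- by move=> l l1; rewrite -points_t //; apply: kj; have := ltn_ord l; lia.
Qed.

Lemma dim_tangent_sum_odd :
  (#|{: multi_index (d4 n)}| <= \dim (tangent_sum (2 * n.+1).+1) + 2)%N.
Proof.
apply: (@dim_ge_of_annihilator K _ _
  [:: ix4 ord0 ord0 (o1 n) (o1 n); ix4 ord0 ord_max ord0 (o1 n)]) => L LT L0.
by apply: (tangent_sum_eq0 (leqnn _) LT); apply: L0; rewrite !inE eqxx ?orbT.
Qed.

Lemma dim_tangent_sum_big :
  (#|{: multi_index (d4 n)}| <= \dim (tangent_sum (2 * n.+1).+2))%N.
Proof.
rewrite -[X in (_ <= X)%N]addn0.
apply: (@dim_ge_of_annihilator K _ _ [::]) => L LT _.
have k0 := tangent_sum_kills LT (j := 0) isT.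
have [_ _ _ k03] := kills_fac4 k0.
have := tangent_sum_kills LT (leqnn _); rewrite points_q => kq.
have [_ kq1 kq2 _] := kills_fac4 kq.
apply: (tangent_sum_eq0 _ LT); first by lia.
  by rewrite -form_delta.
have := kq2 (eN ord0); rewrite formR !form_delta mul1r.
by have := k03 (eN (o1 n)); rewrite form_delta => ->; rewrite add0r.
Qed.

(** The only relation between the tangent spaces at the [2 * n.+1 + 1] points
    involves those at 0, 1 and infinity: the derivative at 1 in the direction
    [e_0 - e_1] of the four factors has no component of weight 2. *)
Lemma dim_tangent_sum_even :
  (2 * n.+1 * (2 * n.+1 + 3) <= \dim (tangent_sum (2 * n.+1)))%N.
Proof.
have := dim_tangent_sum_odd; rewrite /tangent_sum big_ord_recr /=.
set A := (\sum_(_ < _) _)%VS; rewrite points_1; set T := tangent_space _.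
have T_dim : (\dim T <= 1 + (2 * n.+1 + 2))%N.
  have := @dim_tangent_le K _ (d4 n) (point_1 K n).
  rewrite big_pos /= => /(_ _)/leq_trans; apply.
    by rewrite -points_1; apply: points_neq0.
  by rewrite /d4 /tnth /=; lia.
have card_idx : #|{: multi_index (d4 n)}| = (4 * n.+2 * n.+2)%N.
  by rewrite card_multi_index big_pos /tnth /=; lia.
suff : (0 < \dim (A :&: T))%N.
  by rewrite card_idx; have := dimv_sum_cap A T; nia.
rewrite lt0n dimv_eq0.
pose e02 := e2 ord0; pose e12 := e2 ord_max.
pose e0N := eN ord0; pose e1N := eN (o1 n).
pose t4 := @tens4 K n.
pose tau : tspace := t4 (e02 - e12) (e02 + e12) (e0N + e1N) (e0N + e1N)
  + t4 (e02 + e12) (e02 - e12) (e0N + e1N) (e0N + e1N)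
  + t4 (e02 + e12) (e02 + e12) (e0N - e1N) (e0N + e1N)
  + t4 (e02 + e12) (e02 + e12) (e0N + e1N) (e0N - e1N).
have tauE : tau = 4%:R *: t4 e02 e02 e0N e0N
  + 2%:R *: (t4 e12 e02 e0N e0N + t4 e02 e12 e0N e0N
             + t4 e02 e02 e1N e0N + t4 e02 e02 e0N e1N)
  - 2%:R *: (t4 e02 e12 e1N e1N + t4 e12 e02 e1N e1N
             + t4 e12 e12 e0N e1N + t4 e12 e12 e1N e0N)
  - 4%:R *: t4 e12 e12 e1N e1N.
  apply: tens4_ext => i j r t; rewrite /tau /t4 !(tens4E, ffunE) !mxE.
  by rewrite /GRing.scale /=; ring.
have tauT : tau \in T.
  have [h0 h1 h2 h3] := tens_subst4 (curve 1) (curve 1) (e0N + e1N) (e0N + e1N).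
  have c1 : curve 1 = e02 + e12 by rewrite /curve scale1r.
  rewrite c1 in h0 h1 h2 h3; rewrite /T /point_1 c1 /tau /t4 -h0 -h1 -h2 -h3.
  by do 3?[apply: memvD]; exact: mem_tangent.
have tauA : tau \in A.
  have TA j : (j < 2 * n.+1)%N -> (tangent_space (points j) <= A)%VS.
    by move=> j_lt; exact: (sumv_sup (Ordinal j_lt)).
  have gt1 : (1 < 2 * n.+1)%N by lia.
  have A0 := subvP (TA 0%N isT); have A1 := subvP (TA 1%N gt1).
  have [h0 h1 h2 h3] := tens_subst4 e02 e02 e0N e0N.
  have [g0 g1 g2 g3] := tens_subst4 e12 e12 e1N e1N.
  have in0 x : t4 x e02 e0N e0N \in A by rewrite /t4 -h0; apply/A0/mem_tangent.
  have in1 x : t4 e02 x e0N e0N \in A by rewrite /t4 -h1; apply/A0/mem_tangent.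
  have in2 x : t4 e02 e02 x e0N \in A by rewrite /t4 -h2; apply/A0/mem_tangent.
  have in3 x : t4 e02 e02 e0N x \in A by rewrite /t4 -h3; apply/A0/mem_tangent.
  have io0 x : t4 x e12 e1N e1N \in A by rewrite /t4 -g0; apply/A1/mem_tangent.
  have io1 x : t4 e12 x e1N e1N \in A by rewrite /t4 -g1; apply/A1/mem_tangent.
  have io2 x : t4 e12 e12 x e1N \in A by rewrite /t4 -g2; apply/A1/mem_tangent.
  have io3 x : t4 e12 e12 e1N x \in A by rewrite /t4 -g3; apply/A1/mem_tangent.
  rewrite tauE; apply: memvB; last exact: memvZ.
  apply: memvB; last by apply: memvZ; do 3?[apply: memvD => //].
  apply: memvD; first exact: memvZ.
  by apply: memvZ; do 3?[apply: memvD => //].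
have tau0 : tau != 0.
  apply/eqP => /ffunP/(_ (ix4 ord0 ord0 ord0 ord0)).
  have o1N : (ord0 == o1 n) = false by rewrite eq_sym (negPf o1_neq0).
  rewrite tauE /t4 !(tens4E, ffunE) !mxE !eqxx o1N /= !(mulr0, mul0r, mulr1).
  rewrite !addr0 !scaler0 subr0 addr0 subr0 => /eqP.
  by rewrite /GRing.scale /= mulr1 -[0](mulr0n 1) natr_eqE.
apply: contra tau0; rewrite -memv0 => /eqP <-.
by apply/memv_capP.
Qed.

(** In the coordinate of index zero, only the points at 0 and 1 contribute. *)
Lemma sum_points_neq0 : \sum_(j < (2 * n.+1).+1) tens (points j) != 0.
Proof.
apply/eqP => /ffunP/(_ (ix4 ord0 ord0 ord0 ord0)); rewrite sum_ffunE ffunE.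
have o1N : (ord0 == o1 n) = false by rewrite eq_sym (negPf o1_neq0).
have tensE a b c e : tens (fac4 a b c e) (ix4 ord0 ord0 ord0 ord0) =
    a 0 ord0 * (b 0 ord0 * (c 0 ord0 * e 0 ord0)) :> K by exact: tens4E.
rewrite big_ord_recr /= points_1 tensE.
have gt0 : (0 < 2 * n.+1)%N by lia.
rewrite (bigD1 (Ordinal gt0)) //= big1 => [|j j0]; last first.
  have {}j0 : nat_of_ord j != 0%N by [].
  rewrite /points (negPf j0) ltn_ord; have [_|j1] := eqVneq (j : nat) 1%N.
    by rewrite tensE !mxE /= !mul0r.
  have lN : (ord0 == inord j./2.+1 :> 'I_n.+2) = false.
    by rewrite -val_eqE /= inordK //; have := ltn_ord j; lia.
  by case: ifP => _; rewrite tensE !mxE !eqxx lN ?o1N ?addr0 !mulr0.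
rewrite {1}/points /= tensE !mxE !eqxx o1N /= !mulr0 !addr0 !mulr1 => /eqP.
by rewrite -[0](mulr0n 1) -[1](mulr1n 1) -natrD natr_eqE.
Qed.

Lemma T_true_even : T_true K (d4 n) (2 * n.+1).
Proof.
apply: (@T_true_of_dim K _ _ _ (fun j => points j)) => [j|].
  exact: points_neq0.
apply: leq_trans dim_tangent_sum_even; rewrite /expected_dim geq_min big_pos /=.
by rewrite /d4 /tnth /=; apply/orP; left; lia.
Qed.

Lemma T_true_big : T_true K (d4 n) (2 * n.+1 + 2).
Proof.
rewrite addn2; apply: (@T_true_of_dim K _ _ _ (fun j => points j)) => [j|].
  exact: points_neq0.
apply: leq_trans dim_tangent_sum_big; rewrite card_multi_index.
by rewrite /expected_dim geq_min leqnn orbT.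
Qed.

Lemma secant_prime_chain e : (e + 3 <= #|{: multi_index (d4 n)}|)%N ->
  has_prime_chain (segre_secant K (d4 n) (2 * n.+1 + 1)) e.
Proof.
move=> e_le; rewrite addn1.
apply: (@prime_chain_of_tangent_spaces K _ _ _ (fun j => points j) pos0) => //.
  exact: sum_points_neq0.
rewrite -(leq_add2r 2); apply: leq_trans dim_tangent_sum_odd.
by rewrite addSnnS.
Qed.

End TangentSums.

(** * Determinants of the flattenings *)

Lemma det_mul_small (A : comNzRingType) p q (M : 'M[A]_(q, p)) (N : 'M[A]_(p, q)) :
  (p < q)%N -> \det (M *m N) = 0.
Proof.
move=> /subnKC; move: (q - p.+1)%N => e eq_q.
move: M N; rewrite -eq_q addSnnS => M N.
have -> : M *m N = row_mx M 0 *m col_mx N (0 : 'M_(e.+1, _)).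
  by rewrite mul_row_col mulmx0 addr0.
rewrite det_mulmx (expand_det_col (row_mx M 0) (rshift p ord0)) big1 ?mul0r //.
by move=> i _; rewrite row_mxEr mxE mul0r.
Qed.

Lemma eq_cofactor_row (A : comNzRingType) p (M N : 'M[A]_p) i j :
  (forall i' j', i' != i -> M i' j' = N i' j') -> cofactor M i j = cofactor N i j.
Proof.
move=> MN; rewrite /cofactor; congr (_ * \det _).
by apply/matrixP => r t; rewrite !mxE MN // eq_sym neq_lift.
Qed.

Lemma det_two_entries (A : comNzRingType) p (M N : 'M[A]_p) i j0 j1 x0 x1 :
  (forall i' j', i' != i -> M i' j' = N i' j') ->
  (forall j, M i j = N i j + (j == j0)%:R * x0 + (j == j1)%:R * x1) ->
  \det M = cofactor N i j0 * x0 + cofactor N i j1 * x1 + \det N.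
Proof.
move=> MN Mi; rewrite (expand_det_row M i) (expand_det_row N i).
under eq_bigr => j _ do rewrite Mi (eq_cofactor_row _ MN) !mulrDl.
have pick k x : \sum_j (j == k)%:R * x * cofactor N i j = cofactor N i k * x.
  rewrite (bigD1 k) //= eqxx mul1r big1 ?addr0 1?mulrC // => j /negPf ->.
  by rewrite !mul0r.
by rewrite !big_split /= !pick -addrA addrC.
Qed.

Lemma cofactorZ (A : comNzRingType) p (M : 'M[A]_p) c i j :
  cofactor (c *: M) i j = c ^+ p.-1 * cofactor M i j.
Proof.
rewrite /cofactor mulrCA -detZ; congr (_ * \det _).
by apply/matrixP => r t; rewrite !mxE.
Qed.

(** The columns of the adjugate are killed by [M], as [M *m \adj M = 0]. *)
Lemma mul_cofactor_row (K : fieldType) p (M : 'M[K]_p) i k :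
  \det M = 0 -> \sum_j M k j * cofactor M i j = 0.
Proof.
move=> M0; have /matrixP/(_ k i) := mul_mx_adj M; rewrite M0 !mxE mul0rn => e.
by rewrite -[RHS]e; apply: eq_bigr => j _; rewrite mxE.
Qed.

(** The cofactor is the determinant of [M] with its row [i] replaced by the basis
    vector of index [k]. *)
Lemma cofactor_neq0 (K : fieldType) p (M : 'M[K]_p) i k :
  (forall v : 'I_p -> K, (forall i', i' != i -> \sum_j M i' j * v j = 0) ->
     v k = 0 -> forall j, v j = 0) ->
  cofactor M i k != 0.
Proof.
move=> ker0; pose N := \matrix_(i', j) if i' == i then (j == k)%:R else M i' j.
have -> : cofactor M i k = \det N.
  rewrite (expand_det_row N i) (bigD1 k) //= mxE !eqxx mul1r big1 ?addr0.
    by apply: eq_cofactor_row => i' j' /negPf i'i; rewrite mxE i'i.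
  by move=> j /negPf jk; rewrite mxE eqxx jk mul0r.
rewrite -det_tr; apply/det0P => -[v vN0 vN]; case/negP: vN0; apply/eqP/rowP => j.
have Nv i' : \sum_j N i' j * v 0 j = 0.
  move/rowP/(_ i'): vN; rewrite !mxE => e.
  by rewrite -[RHS]e; apply: eq_bigr => j' _; rewrite !mxE mulrC.
rewrite mxE; apply: (ker0 (fun j => v 0 j)) => [i' /negPf i'i|].
  by rewrite -[RHS](Nv i'); apply: eq_bigr => j' _; rewrite mxE i'i.
rewrite -[RHS](Nv i) (bigD1 k) //= mxE !eqxx mul1r big1 ?addr0 //.
by move=> j' /negPf j'k; rewrite mxE eqxx j'k mul0r.
Qed.

Section Flattenings.

Variable n : nat.
Local Notation idx := (multi_index (d4 n)).
Local Notation m := n.+2.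

Definition xu : idx := ix4 ord_max ord_max ord0 ord0.
Definition xv : idx := ix4 ord_max ord_max ord0 (o1 n).
Definition row_uv : 'I_(m + m) := rshift m ord0.
Definition col_u : 'I_(m + m) := rshift m ord0.
Definition col_v : 'I_(m + m) := rshift m (o1 n).

Section OverRing.

Variable A : comNzRingType.
Implicit Type W : idx -> A.

(** The flattenings pairing the first factor with the third one ([b = true]) or
    with the fourth one ([b = false]); the rows are indexed by the pair that
    contains the third factor. *)
Definition slice (b : bool) W i j : 'M[A]_m :=
  \matrix_(r, t) W (if b then ix4 i j r t else ix4 j i r t).

Definition flattening b W : 'M[A]_(m + m) :=
  block_mx (slice b W ord0 ord0) (slice b W ord0 ord_max)
           (slice b W ord_max ord0) (slice b W ord_max ord_max).

Definition zero_uv W x := if (x == xu) || (x == xv) then 0 else W x.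

Definition cof_u b W : A := cofactor (flattening b (zero_uv W)) row_uv col_u.
Definition cof_v b W : A := cofactor (flattening b (zero_uv W)) row_uv col_v.
Definition cof_1 b W : A := \det (flattening b (zero_uv W)).

(** The two flattening determinants are affine functions of the coordinates
    [xu] and [xv], which lie on the same row of both matrices; [Delta], [num_u]
    and [num_v] are given by Cramer's rule for this system. *)
Definition Delta W := cof_u true W * cof_v false W - cof_u false W * cof_v true W.
Definition num_u W := cof_v true W * cof_1 false W - cof_v false W * cof_1 true W.
Definition num_v W := cof_u false W * cof_1 true W - cof_u true W * cof_1 false W.

Lemma flattening_zero_uv b W :
  (forall i j, i != row_uv -> flattening b W i j = flattening b (zero_uv W) i j) /\
  (forall j, flattening b W row_uv j = flattening b (zero_uv W) row_uv j
     + (j == col_u)%:R * W xu + (j == col_v)%:R * W xv).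
Proof.
have zero_uvN x : x != xu -> x != xv -> zero_uv W x = W x.
  by rewrite /zero_uv => /negPf -> /negPf ->.
have NN i j r t : [|| i == ord0, j == ord0 | r != ord0] ->
    zero_uv W (ix4 i j r t) = W (ix4 i j r t).
  by move=> h; rewrite zero_uvN // ix4_eq;
    apply: contraTN h => /and4P[/eqP-> /eqP-> /eqP-> _]; rewrite eqxx.
have ne_uv (r : 'I_m) : (rshift m r != row_uv) = (r != ord0).
  by rewrite (inj_eq (@rshift_inj _ _)).
have uvE t : W (ix4 ord_max ord_max ord0 t) = zero_uv W (ix4 ord_max ord_max ord0 t)
    + (t == ord0)%:R * W xu + (t == o1 n)%:R * W xv.
  rewrite /zero_uv /xu /xv !ix4_eq !eqxx /=; have [->|_] := eqVneq t ord0.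
    by rewrite eq_sym (negPf (o1_neq0 n)) mul1r mul0r add0r addr0.
  have [->|_] := eqVneq t (o1 n); first by rewrite mul0r mul1r !add0r.
  by rewrite !mul0r !addr0.
have col_lr (t : 'I_m) : ((lshift m t == col_u) = false) *
    ((lshift m t == col_v) = false).
  by split; apply: eq_lrshift.
have col_rr (t : 'I_m) : ((rshift m t == col_u) = (t == ord0)) *
    ((rshift m t == col_v) = (t == o1 n)).
  by split; apply: (inj_eq (@rshift_inj _ _)).
pose blockE := (block_mxEul, block_mxEur, block_mxEdl, block_mxEdr).
have rowE : row_uv = rshift m ord0 by [].
split=> [i j|j].
- case: (split_ordP i) => r ->; rewrite ?ne_uv => r0;
    case: (split_ordP j) => t ->; rewrite !blockE !mxE;
    by case: b; rewrite NN ?r0 ?orbT.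
- rewrite rowE; case: (split_ordP j) => t ->; rewrite !blockE !mxE.
    by rewrite !col_lr !mul0r !addr0; case: b; rewrite NN ?orbT.
  by rewrite !col_rr if_same uvE.
Qed.

Lemma cof_uE b W : cof_u b W = cofactor (flattening b W) row_uv col_u.
Proof. by apply/esym/eq_cofactor_row => i j; case: (flattening_zero_uv b W) => h _ /h. Qed.

Lemma cof_vE b W : cof_v b W = cofactor (flattening b W) row_uv col_v.
Proof. by apply/esym/eq_cofactor_row => i j; case: (flattening_zero_uv b W) => h _ /h. Qed.

Lemma det_flattening b W :
  \det (flattening b W) = cof_u b W * W xu + cof_v b W * W xv + cof_1 b W.
Proof. by have [h1 h2] := flattening_zero_uv b W; exact: det_two_entries. Qed.

Lemma flattening_cramer W : (forall b, \det (flattening b W) = 0) ->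
  Delta W * W xu = num_u W /\ Delta W * W xv = num_v W.
Proof.
move=> W0; have := W0 true; have := W0 false; rewrite !det_flattening => e2 e1.
have e1' : cof_1 true W = - (cof_u true W * W xu + cof_v true W * W xv).
  by apply/eqP; rewrite -addr_eq0 addrC e1.
have e2' : cof_1 false W = - (cof_u false W * W xu + cof_v false W * W xv).
  by apply/eqP; rewrite -addr_eq0 addrC e2.
by rewrite /Delta /num_u /num_v e1' e2'; split; ring.
Qed.

Lemma eq_flattening b W W' : W =1 W' -> flattening b W = flattening b W'.
Proof.
move=> e; rewrite /flattening; congr block_mx;
  by apply/matrixP => r t; rewrite !mxE e.
Qed.

Lemma eq_zero_uv W W' : W =1 W' -> zero_uv W =1 zero_uv W'.
Proof. by move=> e x; rewrite /zero_uv e. Qed.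

Lemma eq_Delta W W' : W =1 W' -> Delta W = Delta W'.
Proof.
by move=> /eq_zero_uv e; rewrite /Delta /cof_u /cof_v !(eq_flattening _ e).
Qed.

Lemma eq_nums W W' : W =1 W' -> num_u W = num_u W' /\ num_v W = num_v W'.
Proof.
by move=> /eq_zero_uv e; rewrite /num_u /num_v /cof_u /cof_v /cof_1 !(eq_flattening _ e).
Qed.

Lemma zero_uv_idem W : zero_uv (zero_uv W) =1 zero_uv W.
Proof. by move=> x; rewrite /zero_uv; case: (_ || _). Qed.

Lemma Delta_zero_uv W : Delta (zero_uv W) = Delta W.
Proof. by rewrite /Delta /cof_u /cof_v !(eq_flattening _ (zero_uv_idem W)). Qed.

Lemma nums_zero_uv W : num_u (zero_uv W) = num_u W /\ num_v (zero_uv W) = num_v W.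
Proof.
by rewrite /num_u /num_v /cof_u /cof_v /cof_1 !(eq_flattening _ (zero_uv_idem W)).
Qed.

Lemma flatteningZ b c W : flattening b (fun x => c * W x) = c *: flattening b W.
Proof.
rewrite scale_block_mx; congr block_mx;
  by apply/matrixP => r t; rewrite !mxE.
Qed.

Lemma DeltaZ c W :
  Delta (fun x => c * W x) = c ^+ (2 * (m + m).-1) * Delta W.
Proof.
have zero_uvZ : zero_uv (fun x => c * W x) =1 (fun x => c * zero_uv W x).
  by move=> x; rewrite /zero_uv; case: ifP; rewrite ?mulr0.
rewrite /Delta /cof_u /cof_v !(eq_flattening _ zero_uvZ) !flatteningZ !cofactorZ.
by rewrite mul2n -addnn exprD; ring.
Qed.

End OverRing.
Section Morphism.

Variables (A B : comNzRingType) (g : {rmorphism A -> B}).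

Lemma map_flattening b W : map_mx g (flattening b W) = flattening b (g \o W).
Proof.
rewrite map_block_mx; congr block_mx; by apply/matrixP => r t; rewrite !mxE.
Qed.

Lemma flattening_zero_uv_morph b W :
  flattening b (zero_uv (g \o W)) = map_mx g (flattening b (zero_uv W)).
Proof.
rewrite map_flattening; apply: eq_flattening => x.
by rewrite /zero_uv /=; case: ifP; rewrite ?rmorph0.
Qed.

Lemma Delta_morph W : g (Delta W) = Delta (g \o W).
Proof.
by rewrite /Delta /cof_u /cof_v !flattening_zero_uv_morph !cofactor_map_mx rmorphB !rmorphM.
Qed.

Lemma nums_morph W : g (num_u W) = num_u (g \o W) /\ g (num_v W) = num_v (g \o W).
Proof.
rewrite /num_u /num_v /cof_u /cof_v /cof_1 !flattening_zero_uv_morph !cofactor_map_mx.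
by rewrite !det_map_mx !rmorphB !rmorphM.
Qed.

End Morphism.

(** On a tensor with [s] terms, the flattenings factor through [A ^ s]. *)
Lemma det_flattening_secant (A : comNzRingType) s
    (y : 'I_s -> forall i : 'I_4, 'I_(tnth (d4 n) i).+1 -> A) (W : idx -> A) b :
  (s < m + m)%N -> (forall x, W x = \sum_j \prod_i y j i (x i)) ->
  \det (flattening b W) = 0.
Proof.
move=> s_lt WE.
have [p [q pq]] : exists p q : 'I_2 -> 'I_s -> A, forall i j k,
    p i k * q j k = if b then y k pos0 i * y k pos1 j else y k pos0 j * y k pos1 i.
  case: b.
    by exists (fun i k => y k pos0 i), (fun i k => y k pos1 i).
  by exists (fun i k => y k pos1 i), (fun i k => y k pos0 i) => i j k; rewrite mulrC.
pose P i : 'M[A]_(m, s) := \matrix_(r, k) (p i k * y k pos2 r).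
pose Q i : 'M[A]_(s, m) := \matrix_(k, t) (q i k * y k pos3 t).
suff -> : flattening b W = col_mx (P ord0) (P ord_max) *m row_mx (Q ord0) (Q ord_max).
  exact: det_mul_small.
have PQ i j r t : W (if b then ix4 i j r t else ix4 j i r t) = (P i *m Q j) r t.
  rewrite mxE WE; apply: eq_bigr => k _; rewrite big_pos !mxE mulrACA pq.
  by case: (b); rewrite /ix4 !ffunE /=; ring.
by rewrite mul_col_row; congr block_mx; apply/matrixP => r t; rewrite -PQ mxE.
Qed.

End Flattenings.

(** * A secant point where Delta does not vanish *)

Section UpperBound.

Variables (K : fieldType) (n : nat).
Local Notation idx := (multi_index (d4 n)).
Local Notation m := n.+2.
Local Notation s := (m + n.+1)%N.
Local Notation tspace := (tensor_space K (d4 n)).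
Local Notation e2 := (e2 K).
Local Notation eN := (@eN K n).

(** The blocks of their sum are [M_00 = 1], [M_10 = E_00], [M_01 = c c^T] and
    [M_11 = c c^T + D], where [c = e_0 + e_1] and [D] is the projection to the
    coordinates of index at least 2.  The Schur complements of [M_00] in the two
    flattenings are then, on the first two coordinates, [0, 0; 1, 1] and
    [0, 1; 0, 1]: they have rank 1 and different kernels. *)
Definition witness_points (j : 'I_s) : factors K (d4 n) :=
  match split j with
  | inl r => fac4 (e2 ord0 + (r == ord0)%:R *: e2 ord_max) (e2 ord0) (eN r) (eN r)
  | inr k => if unlift ord0 k is Some _
             then fac4 (e2 ord_max) (e2 ord_max) (eN (lift ord0 k)) (eN (lift ord0 k))
             else fac4 (e2 ord0 + e2 ord_max) (e2 ord_max)
                    (eN ord0 + eN (o1 n)) (eN ord0 + eN (o1 n))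
  end.

Definition witness : tspace := \sum_j tens (witness_points j).

Definition witness_at (x : idx) : K := witness x.

Definition act (W : idx -> K) i j r (y : 'I_m -> K) := \sum_t W (ix4 i j r t) * y t.

Lemma act_tens4 a b c e i j r y :
  act (tens4 a b c e) i j r y = a 0 i * b 0 j * c 0 r * \sum_t e 0 t * y t.
Proof.
by rewrite mulr_sumr; apply: eq_bigr => t _; rewrite tens4E; ring.
Qed.

Lemma act_sum (T : finType) (w : T -> tspace) i j r y :
  act (\sum_t w t) i j r y = \sum_t act (w t) i j r y.
Proof.
rewrite /act exchange_big; apply: eq_bigr => t _.
by rewrite sum_ffunE mulr_suml.
Qed.

Lemma eN_dot r y : \sum_t eN r 0 t * y t = y r.
Proof.
rewrite (bigD1 r) //= mxE !eqxx mul1r big1 ?addr0 // => t tr.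
by rewrite mxE (negPf tr) andbF mul0r.
Qed.

Lemma act_witness i j r y : act witness_at i j r y =
  (if j == ord0 then if i == ord0 then y r else (r == ord0)%:R * y ord0
   else (r < 2)%N%:R * (y ord0 + y (o1 n)) + (i == ord_max)%:R * ((1 < r)%N%:R * y r)).
Proof.
rewrite -[act _ _ _ _ _]/(act witness i j r y) /witness act_sum big_split_ord /=.
under eq_bigr => k _ do rewrite /witness_points (unsplitK (inl _)) act_tens4 eN_dot.
under [X in _ + X]eq_bigr => k _ do rewrite /witness_points (unsplitK (inr _)).
rewrite [X in _ + X]big_ord_recl unlift_none act_tens4.
under [X in _ + (_ + X)]eq_bigr => k _ do rewrite liftK act_tens4 eN_dot.
have -> : \sum_t (eN ord0 + eN (o1 n)) 0 t * y t = y ord0 + y (o1 n).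
  under eq_bigr do rewrite mxE mulrDl.
  by rewrite big_split /= !eN_dot.
rewrite (bigD1 r) //= big1 ?addr0 => [|k kr]; last first.
  by rewrite [eN _ _ _]mxE [r == k]eq_sym (negPf kr) andbF mulr0 mul0r.
have tail (c : K) : \sum_(k < n) c * eN (lift ord0 (lift ord0 k)) 0 r *
    y (lift ord0 (lift ord0 k)) = c * ((1 < r)%N%:R * y r).
  have [r_le|r_gt] := leqP r 1.
    rewrite mul0r mulr0 big1 // => k _; rewrite mxE /= (_ : _ == _ = false) ?mulr0 ?mul0r //.
    by apply: contraTF r_le => /eqP ->.
  have k_lt : (r - 2 < n)%N by have := ltn_ord r; lia.
  have rE : r = lift ord0 (lift ord0 (Ordinal k_lt)).
    by apply: val_inj; rewrite /= /bump /=; lia.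
  rewrite (bigD1 (Ordinal k_lt)) //= -rE mxE !eqxx big1 ?addr0 => [|k kk].
    by rewrite mulr1 mul1r.
  rewrite mxE /= {1}rE !(inj_eq (@lift_inj _ _)) eq_sym (negPf kk).
  by rewrite mulr0 mul0r.
rewrite tail !mxE !eqxx /=; have eo : (r < 2)%N%:R = (r == ord0)%:R + (r == o1 n)%:R :> K.
  have [|r_ge] := ltnP r 2.
    case/small_index=> ->; first by rewrite eqxx eq_sym (negPf (o1_neq0 n)) addr0.
    by rewrite eqxx (negPf (o1_neq0 n)) add0r.
  rewrite -!val_eqE /= inordK //; case: eqP => [r0|_]; first by rewrite r0 in r_ge.
  by case: eqP => [r0|_]; [rewrite r0 in r_ge | rewrite addr0].
have y0 : (r == ord0)%:R * y r = (r == ord0)%:R * y ord0 :> K.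
  by case: eqP => [->|_]; rewrite ?mul0r.
rewrite eo; elim/ord2_ind: i; elim/ord2_ind: j;
  by rewrite /= ?(mulr1, mulr0, mul1r, mul0r, addr0, add0r).
Qed.

Lemma row_flattening b W (i : 'I_2) r (v : 'I_(m + m) -> K) :
  \sum_j flattening b W (if i == ord0 then lshift m r else rshift m r) j * v j =
  (if b then act W i ord0 r (fun t => v (lshift m t))
             + act W i ord_max r (fun t => v (rshift m t))
   else act W ord0 i r (fun t => v (lshift m t))
        + act W ord_max i r (fun t => v (rshift m t))).
Proof.
rewrite big_split_ord /=; elim/ord2_ind: i; case: b => /=; congr (_ + _);
  by apply: eq_bigr => t _;
     rewrite ?(block_mxEul, block_mxEur, block_mxEdl, block_mxEdr) !mxE.
Qed.

Lemma witness_det b : \det (flattening b witness_at) = 0.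
Proof.
apply: (@det_flattening_secant n K s
  (fun j i c => witness_points j i 0 c) witness_at b).
  by rewrite ltn_add2l.
by move=> x; rewrite /witness_at sum_ffunE; apply: eq_bigr => j _; rewrite ffunE.
Qed.

Lemma witness_row b (v : 'I_(m + m) -> K) (i : 'I_2) r :
  \sum_j flattening b witness_at (if i == ord0 then lshift m r else rshift m r) j * v j = 0 ->
  let y0 t := v (lshift m t) in let y1 t := v (rshift m t) in
  let e := (r == ord0)%:R in let f := (r < 2)%N%:R in let g := (1 < r)%N%:R in
  (if b then
     if i == ord0 then y0 r + f * (y1 ord0 + y1 (o1 n))
     else e * y0 ord0 + (f * (y1 ord0 + y1 (o1 n)) + g * y1 r)
   else
     if i == ord0 then y0 r + e * y1 ord0
     else f * (y0 ord0 + y0 (o1 n)) + (f * (y1 ord0 + y1 (o1 n)) + g * y1 r)) = 0.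
Proof.
rewrite row_flattening !act_witness; elim/ord2_ind: i; case: b => /=;
  by rewrite ?(mul0r, mul1r, addr0).
Qed.

Lemma cof_u_witness b : cof_u b witness_at != 0.
Proof.
rewrite cof_uE; apply: cofactor_neq0 => v rows v_u.
have u0 : v (rshift m ord0) = 0 by [].
have low r : (if b then v (lshift m r) + (r < 2)%N%:R * (v (rshift m ord0) + v (rshift m (o1 n)))
    else v (lshift m r) + (r == ord0)%:R * v (rshift m ord0)) = 0.
  by have := @witness_row b v ord0 r; rewrite /=; apply; apply: rows; rewrite eq_lrshift.
have high r : r != ord0 -> (if b then (r == ord0)%:R * v (lshift m ord0)
      + ((r < 2)%N%:R * (v (rshift m ord0) + v (rshift m (o1 n))) + (1 < r)%N%:R * v (rshift m r))
    else (r < 2)%N%:R * (v (lshift m ord0) + v (lshift m (o1 n)))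
      + ((r < 2)%N%:R * (v (rshift m ord0) + v (rshift m (o1 n)))
         + (1 < r)%N%:R * v (rshift m r))) = 0.
  move=> r0; have := @witness_row b v ord_max r; rewrite /=; apply; apply: rows.
  by rewrite (inj_eq (@rshift_inj _ _)).
have o1lt : (o1 n < 2)%N by rewrite inordK.
have o1E : (1 < o1 n)%N = false by rewrite ltnNge -ltnS o1lt.
have v1 : v (rshift m (o1 n)) = 0.
  have := high _ (o1_neq0 n); rewrite o1lt o1E (negPf (o1_neq0 n)) u0.
  case: (b) low => low; rewrite !(mul0r, mul1r, add0r, addr0) //.
  have := low ord0; have := low (o1 n); rewrite u0 !mulr0 !addr0 => -> ->.
  by rewrite !add0r.
have v0 r : v (lshift m r) = 0.
  by have := low r; rewrite u0 v1; case: (b); rewrite !(addr0, mulr0).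
move=> j; case: (split_ordP j) => r -> //.
have [/small_index[]-> //|r_gt] := ltnP r 2.
have r0 : r != ord0 by apply: contraTneq r_gt => ->.
have := high r r0; rewrite u0 v1 !v0 r_gt.
by case: (b); rewrite !(addr0, mulr0, add0r, mul1r).
Qed.

(** The rows of cofactors of the two flattenings are proportional to [(1, -1)] and
    [(1, 0)] on the columns [col_u] and [col_v]. *)
Lemma Delta_witness : Delta witness_at != 0.
Proof.
have rows b i r := @witness_row b _ i r (mul_cofactor_row (row_uv n) _ (witness_det b)).
have o1lt : (o1 n < 2)%N by rewrite inordK.
have o1E : (1 < o1 n)%N = false by rewrite ltnNge -ltnS o1lt.
have o1N := negPf (o1_neq0 n).
have := rows true ord_max (o1 n); have := rows false ord_max (o1 n).
have := rows false ord0 (o1 n); have := rows false ord0 ord0.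
rewrite /= o1lt o1E o1N !(mul0r, mul1r, add0r, addr0).
rewrite -!/(col_u n) -!/(col_v n) -!cof_uE -!cof_vE => f0 -> + t1.
rewrite addr0 addrA f0 add0r => f1.
rewrite /Delta f1 mulr0 sub0r -mulrN.
have -> : cof_v true witness_at = - cof_u true witness_at.
  by apply/eqP; rewrite -addr_eq0 addrC t1.
by rewrite opprK mulf_neq0 ?cof_u_witness.
Qed.

End UpperBound.

(** * Elimination of two coordinates *)

Lemma secant_pointE (K : fieldType) k (d : k.-tuple nat) (i0 : 'I_k) s
    (p : 'I_s -> tensor_space K d) w :
  (forall j, segre (p j)) -> w \in (\sum_(j < s) <[p j]>)%VS ->
  exists u : 'I_s -> factors K d, w = \sum_j tens (u j).
Proof.
move=> pX /memv_sumP[q qp ->].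
have [j|u uE] := @fin_all_exists _ (fun=> factors K d)
    (fun (j : 'I_s) (u : factors K d) => q j = tens u); last first.
  by exists u; apply: eq_bigr.
have [v _ pv] := pX j; have /vlineP[c ->] := qp j isT.
exists (dfwith v (c *: v i0)); rewrite -[RHS]/(tens_subst v (c *: v i0)).
by rewrite linearZ /= tens_subst_id pv.
Qed.

Section Elimination.

Variables (K : fieldType) (n : nat).
Local Notation idx := (multi_index (d4 n)).
Local Notation m := n.+2.
Local Notation s := (m + n.+1)%N.

Definition free_idx := {x : idx | (x != xu n) && (x != xv n)}.
Local Notation r := #|{: free_idx}|.
Local Notation P := {mpoly K[r]}.

Lemma card_free_idx : (r + 2)%N = #|{: idx}|.
Proof.
rewrite card_sig -(cardC [pred x : idx | (x != xu n) && (x != xv n)]).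
congr (_ + _)%N; rewrite (eq_card (B := pred2 (xu n) (xv n))) => [|x].
  by rewrite card2 ix4_eq !eqxx /= eq_sym (negPf (o1_neq0 n)).
by rewrite !inE negb_and !negbK.
Qed.

Definition generic_tensor (x : idx) : P :=
  if insub x is Some t then 'X_(enum_rank (t : free_idx)) else 0.

(** On a secant variety where the two determinants vanish, a tensor multiplied
    by [Delta] is a polynomial in all its coordinates but two. *)
Definition eliminate (x : idx) : P :=
  if x == xu n then num_u generic_tensor
  else if x == xv n then num_v generic_tensor
  else Delta generic_tensor * generic_tensor x.

Lemma eliminate_eval (A : comNzRingType) (g : {rmorphism P -> A}) (W : idx -> A) :
  (forall b, \det (flattening b W) = 0) ->
  (forall t : free_idx, g 'X_(enum_rank t) = W (val t)) ->
  forall x, g (eliminate x) = Delta W * W x.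
Proof.
move=> W0 gW x; have gE : g \o generic_tensor =1 zero_uv W.
  move=> y; rewrite /= /generic_tensor; case: (insubP free_idx y) => [t yP ty|yP].
    by rewrite gW ty /zero_uv ifF //; apply: negbTE; rewrite negb_or.
  by rewrite /zero_uv ifT ?rmorph0 // -[_ || _]negbK negb_or.
have [Wu Wv] := flattening_cramer W0; have [hu hv] := nums_zero_uv W.
have [eu ev] := eq_nums gE; have [gu gv] := nums_morph g generic_tensor.
rewrite /eliminate; case: eqP => [->|/eqP xNu]; first by rewrite gu eu hu -Wu.
case: eqP => [->|/eqP xNv]; first by rewrite gv ev hv -Wv.
rewrite rmorphM Delta_morph (eq_Delta gE) Delta_zero_uv; congr (_ * _).
by rewrite -[LHS]/((g \o generic_tensor) x) gE /zero_uv (negPf xNu) (negPf xNv).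
Qed.

(** On the secant cone, [eliminate] evaluates to [Delta W * W].  The scalar
    [Delta W] is not constant, so the homogeneous components of [F] are separated
    by a homothety first, and [Delta W] is then cancelled along a segment that
    joins a given secant point to one where it is not zero. *)
Lemma eliminate_kernel F e :
  ev (@mpolyC r K) eliminate F = 0 ->
  vanishes_on (pihomog mdeg e F) (segre_secant K (d4 n) s).
Proof.
move=> F0 w [w0 wZ]; apply: (wZ e); first exact: pihomogP.
move=> {wZ w0} w [_ [p [pX wp]]]; have [u uE] := secant_pointE pos0 pX wp.
(* the segment from [w] to the witness, inside the secant cone *)
pose y j (i : 'I_4) (b : 'I_(tnth (d4 n) i).+1) : {poly K} :=
  (u j i 0 b)%:P + (witness_points K j i 0 b - u j i 0 b)%:P * 'X.
pose W (x : idx) : {poly K} := \sum_(j < s) \prod_i y j i (x i).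
have W_at c x : (W x).[c] =
    \sum_(j < s) \prod_i (u j i 0 (x i) + (witness_points K j i 0 (x i) - u j i 0 (x i)) * c).
  rewrite horner_sum; apply: eq_bigr => j _; rewrite horner_prod.
  by apply: eq_bigr => i _; rewrite !hornerE.
have W_at0 x : (W x).[0] = w x.
  rewrite W_at uE sum_ffunE; apply: eq_bigr => j _; rewrite ffunE.
  by apply: eq_bigr => i _; rewrite mulr0 addr0.
have W_at1 x : (W x).[1] = witness_at K x.
  rewrite W_at /witness_at sum_ffunE; apply: eq_bigr => j _; rewrite ffunE.
  by apply: eq_bigr => i _; rewrite mulr1 addrC subrK.
have W_det b : \det (flattening b W) = 0.
  by apply: (@det_flattening_secant n _ s y W b) => //; rewrite ltn_add2l.
have W_Delta : Delta W != 0.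
  apply: contraNneq (Delta_witness K n) => D0.
  have := Delta_morph (horner_eval (1 : K)) W; rewrite D0 rmorph0.
  by move=> ->; apply/eqP/eq_Delta => x; rewrite /= /horner_eval W_at1.
pose W' x : {poly {poly K}} := 'X * (W x)%:P.
have W'_det b : \det (flattening b W') = 0.
  rewrite flatteningZ detZ; have := @map_flattening n _ _ polyC b W; rewrite /comp => <-.
  by rewrite det_map_mx W_det rmorph0 mulr0.
pose g : {rmorphism P -> {poly {poly K}}} :=
  mmap (polyC \o polyC) (fun t => W' (val (enum_val t))).
have gE x : g (eliminate x) = 'X^((2 * (m + m).-1).+1) * (Delta W * W x)%:P.
  rewrite (eliminate_eval (W := W')) // => [|t].
    rewrite /W' DeltaZ -(Delta_morph polyC) exprSr polyCM; ring.
  by rewrite /g /= mmapX mmap1U enum_rankK.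
have := congr1 g F0; rewrite rmorph0.
rewrite (ev_comp (g := g) (h := polyC \o polyC)) => [|c]; last first.
  by rewrite /g /= mmapC.
rewrite (@eq_ev _ _ _ _ _ _ _ gE) => F'0.
have := @ev_scale_eq0 K _ {poly K} polyC _ (polyC \o polyC) (fun x => Delta W * W x) F e
  (ltn0Sn _) (fun=> erefl) F'0.
rewrite (ev_homog _ _ _ (pihomogP _ _ _)) => /eqP.
rewrite mulf_eq0 expf_eq0 (negPf W_Delta) andbF /= => /eqP/(congr1 (horner_eval 0)).
rewrite rmorph0 (ev_comp (h := idfun)) => [|c]; last by rewrite /= /horner_eval hornerC.
rewrite (@eq_ev _ _ _ _ _ _ _ W_at0) => <-; by [].
Qed.

End Elimination.

(** * The dimension of the secant variety *)

Lemma secant_chain_bound (K : fieldType) n e :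
  has_prime_chain (segre_secant K (d4 n) (2 * n.+1 + 1)) e ->
  (e + 3 <= #|{: multi_index (d4 n)}|)%N.
Proof.
have -> : (2 * n.+1 + 1 = n.+2 + n.+1)%N by lia.
move/(prime_chain_lt (@eliminate_kernel K n)); rewrite -card_free_idx.
by rewrite addn3 addn2.
Qed.

Lemma secant_proj_dim (K : fieldType) (charK0 : [pchar K] =i pred0) n e :
  (e + 3)%N = #|{: multi_index (d4 n)}| ->
  proj_dim (segre_secant K (d4 n) (2 * n.+1 + 1)) e.
Proof.
move=> eE; split; first by apply: secant_prime_chain => //; rewrite eE.
by move=> e' /secant_chain_bound; rewrite -eE leq_add2r.
Qed.

Local Close Scope ring_scope.

Theorem proposition4p7 (K : fieldType) (charK0 : [pchar K]%R =i pred0)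
    (n : nat) (n_ge1 : (1 <= n)%N) :
  [/\ (* (i) *)
      defective K [tuple 1; 1; n; n] (2 * n + 1)%N,
      (* (ii) *)
      exists2 e : nat,
        proj_dim (segre_secant K [tuple 1; 1; n; n] (2 * n + 1)%N) e &
        (e + 2 = 4 * (n + 1) ^ 2 - 1)%N
    & (* (iii) *)
      T_true K [tuple 1; 1; n; n] (2 * n)%N /\
      T_true K [tuple 1; 1; n; n] (2 * n + 2)%N].
Proof.
case: n n_ge1 => // n _; rewrite -!/(d4 n).
have card_idx : #|{: multi_index (d4 n)}| = (4 * n.+2 ^ 2)%N.
  by rewrite card_multi_index big_pos /tnth /=; lia.
pose e := (4 * n.+2 ^ 2 - 3)%N.
have eE : (e + 3)%N = #|{: multi_index (d4 n)}| by rewrite card_idx /e; lia.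
have e_dim := secant_proj_dim charK0 eE.
split; last by split; [exact: T_true_even | exact: T_true_big].
  exists e => //; rewrite !big_pos /tnth /= /e; lia.
by exists e => //; rewrite addn1 /e; lia.
Qed.
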